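(* (Timelike Björling representation.) Let $X:\mathfrak O\subset\mathbb C'\to\mathbb L^3$ be a timelike minimal surface in $\mathbb L^3$ with Gauss map $N$, and set $\gamma(t)=X(t,0)$, $W(t)=N(t,0)$ on a real interval $I$ in $\mathfrak O$. Choose any simply connected region $\mathfrak R\subset\mathfrak O$ containing $I$ over which split-holomorphic extensions $\gamma(z),W(z)$ of $\gamma$ and $W$ can be defined for all $z\in\mathfrak R$. Then for all $z\in\mathfrak R$ $$X(z)=\mathrm{Re}\left(\gamma(z)+k'\int_{t_o}^{z}W(w)\times\gamma'(w)\,dw\right),$$ where $t_o$ is an arbitrary fixed point in $I$ and the path integral is taken over any path in $\mathfrak R$ from $t_o$ to $z$.
   Context: $\mathbb C'=\{t+k's: t,s\in\mathbb R\}$ is the commutative real algebra of split-complex numbers, with $k'^2=1$, $\mathrm{Re}(t+k's)=t$, $\mathrm{Im}(t+k's)=s$, topologized as $\mathbb R^2$; a real number $t$ is identified with $t+k'0$, i.e. with the point $(t,0)$. A function $f(t+k's)=u(t,s)+k'v(t,s)$ is split-holomorphic if $u_t=v_s$ and $u_s=v_t$; then $f'(z)=u_t+k'v_t$. Line integrals use $dz=dt+k'ds$. Split-holomorphic extensions of vector-valued functions are taken componentwise. $\mathbb L^3$ is $\mathbb R^3$ with $\langle x,y\rangle=-x_1y_1+x_2y_2+x_3y_3$. The Lorentzian cross product is defined by $\langle u\times v,w\rangle=\det[u,v,w]$ and is extended $\mathbb C'$-bilinearly to $(\mathbb C')^3$. A timelike surface $X:\mathfrak O\to\mathbb L^3$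 (with $\mathfrak O\subset\mathbb C'$ a domain) is an immersion inducing a metric of signature $(1,1)$; it is parametrized by conformal coordinates $z=t+k's$, meaning $\langle X_t,X_s\rangle=0$ and $\langle X_s,X_s\rangle=-\langle X_t,X_t\rangle>0$. It is minimal if its mean curvature vanishes, equivalently $X_{tt}=X_{ss}$ in these coordinates. The Gauss map $N$ is the unit spacelike normal field, oriented so that $N\times X_t=X_s$ and $N\times X_s=X_t$. Standing assumption: all functions, curves, surfaces and extensions considered are real analytic. *)

(* Defs.v *)
From HB Require Import structures.
From mathcomp Require Import all_boot all_order all_algebra.
From mathcomp Require Import all_classical all_reals all_analysis.
From mathcomp Require Import ring.
Set Implicit Arguments.
Unset Strict Implicit.
Unset Printing Implicit Defensive.
Import Order.TTheory GRing.Theory Num.Theory.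
Import numFieldNormedType.Exports.
Local Open Scope classical_set_scope.
Local Open Scope ring_scope.

Record splitC (R : realType) : Type :=
  SplitC { split_Re : R; split_Im : R }.
Arguments split_Re {R} _.
Arguments split_Im {R} _.

Section SplitComplex.
Context {R : realType}.
Implicit Types z w : splitC R.

Definition pair_of_split z : R * R := (split_Re z, split_Im z).
Definition split_of_pair (p : R * R) : splitC R := SplitC p.1 p.2.

Lemma pair_of_splitK : cancel pair_of_split split_of_pair.
Proof. by case. Qed.

HB.instance Definition _ := Choice.copy (splitC R) (can_type pair_of_splitK).

Definition split_add z w : splitC R :=
  SplitC (split_Re z + split_Re w) (split_Im z + split_Im w).
Definition split_opp z : splitC R := SplitC (- split_Re z) (- split_Im z).
Definition split_zero : splitC R := SplitC 0 0.
Definition split_one : splitC R := SplitC 1 0.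
Definition split_mul z w : splitC R :=
  SplitC (split_Re z * split_Re w + split_Im z * split_Im w)
         (split_Re z * split_Im w + split_Im z * split_Re w).
Definition split_scale (a : R) z : splitC R :=
  SplitC (a * split_Re z) (a * split_Im z).
Definition split_norm z : R := Num.max `|split_Re z| `|split_Im z|.

Let addA : associative split_add.
Proof. by move=> [a b] [c d] [e f]; congr SplitC => /=; ring. Qed.

Let addC : commutative split_add.
Proof. by move=> [a b] [c d]; congr SplitC => /=; ring. Qed.

Let add0 : left_id split_zero split_add.
Proof. by move=> [a b]; congr SplitC => /=; ring. Qed.

Let addN : left_inverse split_zero split_opp split_add.
Proof. by move=> [a b]; congr SplitC => /=; ring. Qed.

HB.instance Definition _ :=
  GRing.isZmodule.Build (splitC R) addA addC add0 addN.

Let mulA : associative split_mul.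
Proof. by move=> [a b] [c d] [e f]; congr SplitC => /=; ring. Qed.

Let mulC : commutative split_mul.
Proof. by move=> [a b] [c d]; congr SplitC => /=; ring. Qed.

Let mul1 : left_id split_one split_mul.
Proof. by move=> [a b]; congr SplitC => /=; ring. Qed.

Let mulDl : left_distributive split_mul +%R.
Proof. by move=> [a b] [c d] [e f]; congr SplitC => /=; ring. Qed.

Let one_neq0 : split_one != 0.
Proof. by apply/eqP => -[/eqP]; rewrite oner_eq0. Qed.

HB.instance Definition _ := GRing.Zmodule_isComNzRing.Build (splitC R)
  mulA mulC mul1 mulDl one_neq0.

Let scaleA (a b : R) z : split_scale a (split_scale b z) = split_scale (a * b) z.
Proof. by case: z => x y; congr SplitC => /=; ring. Qed.

Let scale1 : left_id 1 split_scale.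
Proof. by move=> [x y]; congr SplitC => /=; ring. Qed.

Let scaleDr : right_distributive split_scale +%R.
Proof. by move=> a [x y] [u v]; congr SplitC => /=; ring. Qed.

Let scaleDl z : {morph split_scale^~ z : a b / a + b}.
Proof. by move=> a b; case: z => x y; congr SplitC => /=; ring. Qed.

HB.instance Definition _ := GRing.Zmodule_isLmodule.Build R (splitC R)
  scaleA scale1 scaleDr scaleDl.

Let scaleAl (a : R) z w : a *: (z * w) = a *: z * w.
Proof. by case: z w => [x y] [u v]; congr SplitC => /=; ring. Qed.

HB.instance Definition _ := GRing.Lmodule_isLalgebra.Build R (splitC R) scaleAl.

Let scaleAr (a : R) z w : a *: (z * w) = z * (a *: w).
Proof. by case: z w => [x y] [u v]; congr SplitC => /=; ring. Qed.

HB.instance Definition _ := GRing.Lalgebra_isAlgebra.Build R (splitC R) scaleAr.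

Let ler_split_normD z w : split_norm (z + w) <= split_norm z + split_norm w.
Proof.
rewrite /split_norm ge_max; apply/andP; split; apply: le_trans (ler_normD _ _) _;
  by apply: lerD; rewrite le_max lexx ?orbT.
Qed.

Let split_normZ (a : R) z : split_norm (a *: z) = `|a| * split_norm z.
Proof. by rewrite /split_norm /= !normrM maxr_pMr. Qed.

Let split_norm_eq0 z : split_norm z = 0 -> z = 0.
Proof.
case: z => x y; rewrite /split_norm /= => n0.
have : `|x| <= 0 by rewrite -n0 le_max lexx.
have : `|y| <= 0 by rewrite -n0 le_max lexx orbT.
by rewrite !normr_le0 => /eqP -> /eqP ->.
Qed.

(* The sup norm only serves to give splitC R the topology of R^2. *)
HB.instance Definition _ := Lmodule_isNormed.Build R (splitC R)
  ler_split_normD split_normZ split_norm_eq0.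

Lemma split_normE z : `|z| = Num.max `|split_Re z| `|split_Im z|.
Proof. by []. Qed.

Definition split_unit : splitC R := SplitC 0 1.
Definition split_real (t : R) : splitC R := SplitC t 0.

Lemma split_unit_sqr : split_unit * split_unit = 1.
Proof. by congr SplitC => /=; ring. Qed.

Lemma splitE (t s : R) :
  SplitC t s = split_real t + split_unit * split_real s.
Proof. by congr SplitC => /=; ring. Qed.

End SplitComplex.

Notation "''k'" := (@split_unit _) (at level 0) : ring_scope.
Notation "t %:SC" := (split_real t) (at level 2, format "t %:SC") : ring_scope.

Section Calculus.
Context {R : realType}.
Implicit Types (A : set (splitC R)).

Definition d_t {V : normedModType R} (f : splitC R -> V) (z : splitC R) : V :=
  'D_(1 : splitC R) f z.
Definition d_s {V : normedModType R} (f : splitC R -> V) (z : splitC R) : V :=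
  'D_('k : splitC R) f z.

(* On each point of a neighbourhood of z0, f is the sum of an absolutely
   convergent double power series in the two real coordinates. *)
Definition real_analytic_at {V : normedModType R} (f : splitC R -> V)
    (z0 : splitC R) : Prop :=
  exists (r : R) (a : nat -> nat -> V), 0 < r /\
    forall z : splitC R, `|z - z0| < r ->
    let m i j := (split_Re (z - z0) ^+ i * split_Im (z - z0) ^+ j) *: a i j in
    cvgn (fun n => \sum_(i < n) \sum_(j < n) `|m i j|) /\
    (fun n => \sum_(i < n) \sum_(j < n) m i j) @ \oo --> f z.

Definition real_analytic {V : normedModType R} A (f : splitC R -> V) : Prop :=
  forall z, A z -> real_analytic_at f z.

Definition split_holomorphic A (f : splitC R -> splitC R) : Prop :=
  let u := split_Re \o f in
  let v := split_Im \o f in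
  forall z, A z ->
  [/\ differentiable u z, differentiable v z,
      d_t u z = d_s v z & d_s u z = d_t v z].

Definition split_deriv (f : splitC R -> splitC R) (z : splitC R) : splitC R :=
  (d_t (split_Re \o f) z)%:SC + 'k * (d_t (split_Im \o f) z)%:SC.

Definition split_deriv_vec (F : splitC R -> 'rV[splitC R]_3) (z : splitC R) :
  'rV[splitC R]_3 := \row_j split_deriv (fun w => F w 0 j) z.

(* Continuity of p on [0, 1] is implied: p agrees on each closed piece with a
   C^1 function. *)
Definition piecewise_C1 (p : R -> splitC R) : Prop :=
  exists s : seq R,
  [/\ path <%R 0 s, last 0 s = 1 &
      forall i, (i < size s)%N -> exists q : R -> splitC R,
      [/\ forall x : R, derivable q x 1, continuous (derive1 q) &
          forall x : R, nth 0 (0 :: s) i <= x <= nth 0 s i -> p x = q x]].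

Definition path_in A (z0 z1 : splitC R) (p : R -> splitC R) : Prop :=
  [/\ piecewise_C1 p, forall x : R, 0 <= x <= 1 -> A (p x), p 0 = z0 & p 1 = z1].

(* The integrand is the split-complex product f(p(x)) p'(x), i.e. the pullback
   of f dz with dz = dt + k' ds. *)
Definition line_integral (f : splitC R -> splitC R) (p : R -> splitC R) :
  splitC R :=
  (\int[lebesgue_measure]_(x in `[0, 1]) split_Re (f (p x) * derive1 p x))%:SC +
  'k * (\int[lebesgue_measure]_(x in `[0, 1])
          split_Im (f (p x) * derive1 p x))%:SC.

Definition line_integral_vec (F : splitC R -> 'rV[splitC R]_3)
    (p : R -> splitC R) : 'rV[splitC R]_3 :=
  \row_j line_integral (fun w => F w 0 j) p.

Definition domain A : Prop := [/\ A !=set0, open A & connected A].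

Definition path_connected A : Prop :=
  forall z0 z1, A z0 -> A z1 -> exists l : R -> splitC R,
  [/\ {within `[0, 1], continuous l}, forall x : R, 0 <= x <= 1 -> A (l x),
      l 0 = z0 & l 1 = z1].

Definition simply_connected A : Prop :=
  path_connected A /\
  forall l : R -> splitC R, {within `[0, 1], continuous l} ->
    (forall x : R, 0 <= x <= 1 -> A (l x)) -> l 0 = l 1 ->
  exists h : R * R -> splitC R,
  [/\ {within `[0, 1] `*` `[0, 1], continuous h},
      forall x y : R, 0 <= x <= 1 -> 0 <= y <= 1 -> A (h (x, y)),
      forall x : R, 0 <= x <= 1 -> h (x, 0) = l x /\ h (x, 1) = l 0 &
      forall y : R, 0 <= y <= 1 -> h (0, y) = l 0 /\ h (1, y) = l 0].

(* A real interval that is not reduced to a point. *)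
Definition nondegenerate_interval (I : set R) : Prop :=
  is_interval I /\ exists a b, [/\ I a, I b & a < b].

(* F is a split-holomorphic extension to A of the curve c on I. *)
Definition split_extension A (I : set R) (c : R -> 'rV[R]_3)
    (F : splitC R -> 'rV[splitC R]_3) : Prop :=
  [/\ forall j, split_holomorphic A (fun z => F z 0 j),
      forall j, real_analytic A (fun z => F z 0 j) &
      forall t, I t -> F t%:SC = map_mx split_real (c t)].

End Calculus.

Section Lorentz.
Context {T : comNzRingType}.
Implicit Types u v w : 'rV[T]_3.

Let i0 : 'I_3 := inord 0.
Let i1 : 'I_3 := inord 1.
Let i2 : 'I_3 := inord 2.

Definition lorentz u v : T :=
  - (u 0 i0 * v 0 i0) + u 0 i1 * v 0 i1 + u 0 i2 * v 0 i2.

Definition rows3 u v w : 'M[T]_3 :=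
  \matrix_(i < 3, j < 3) nth 0 [:: u 0 j; v 0 j; w 0 j] i.

(* Over T = splitC R this is the bilinear extension of the real product. *)
Definition cross u v : 'rV[T]_3 :=
  \row_j nth 0 [:: u 0 i2 * v 0 i1 - u 0 i1 * v 0 i2;
                   u 0 i2 * v 0 i0 - u 0 i0 * v 0 i2;
                   u 0 i0 * v 0 i1 - u 0 i1 * v 0 i0] j.

Lemma crossP u v w : lorentz (cross u v) w = \det (rows3 u v w).
Proof.
have E (x : 'rV[T]_3) j : x 0 j = x 0 (inord j) by rewrite inord_val.
rewrite (expand_det_row _ ord0) !big_ord_recl big_ord0 /cofactor.
rewrite !(expand_det_row _ ord0) !big_ord_recl !big_ord0 /cofactor !det_mx11.
rewrite /lorentz !mxE /= ?inordK //=.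
rewrite !(E u (lift _ _)) !(E v (lift _ _)) !(E w (lift _ _)).
rewrite (E u ord0) /= /bump /=.
by rewrite /i0 /i1 /i2; ring.
Qed.

End Lorentz.

Section Surfaces.
Context {R : realType}.
Implicit Types (O : set (splitC R)) (X N : splitC R -> 'rV[R]_3).

Definition coord_deriv {V : normedModType R} (i : 'I_2) (f : splitC R -> V) :
  splitC R -> V := if i == 0 then d_t f else d_s f.

Definition jacobian X (z : splitC R) : 'M[R]_(2, 3) :=
  \matrix_(i < 2, j < 3) coord_deriv i X z 0 j.

Definition first_form X (z : splitC R) : 'M[R]_2 :=
  \matrix_(i, j) lorentz (coord_deriv i X z) (coord_deriv j X z).

Definition second_form X N (z : splitC R) : 'M[R]_2 :=
  \matrix_(i, j) lorentz (coord_deriv i (coord_deriv j X) z) (N z).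

Definition signature11 (g : 'M[R]_2) : Prop :=
  exists2 P : 'M[R]_2, P \in unitmx &
    P *m g *m P^T = \matrix_(i, j) (if i == j then (-1) ^+ i.+1 else 0).

Definition timelike_surface O X : Prop :=
  [/\ domain O, real_analytic O X,
      forall z, O z -> row_free (jacobian X z) &
      forall z, O z -> signature11 (first_form X z)].

Definition conformal O X : Prop :=
  forall z, O z ->
  [/\ lorentz (d_t X z) (d_s X z) = 0,
      lorentz (d_s X z) (d_s X z) = - lorentz (d_t X z) (d_t X z) &
      0 < lorentz (d_s X z) (d_s X z)].

Definition gauss_map O X N : Prop :=
  real_analytic O N /\
  forall z, O z ->
  [/\ lorentz (N z) (N z) = 1,
      lorentz (N z) (d_t X z) = 0, lorentz (N z) (d_s X z) = 0,
      cross (N z) (d_t X z) = d_s X z & cross (N z) (d_s X z) = d_t X z].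

(* Half the trace of the shape operator. *)
Definition mean_curvature X N (z : splitC R) : R :=
  2^-1 * \tr (invmx (first_form X z) *m second_form X N z).

Definition minimal O X N : Prop :=
  forall z, O z -> mean_curvature X N z = 0.

End Surfaces.

(* Main.v *)
Require Import Defs.
From HB Require Import structures.
From mathcomp Require Import all_boot all_order all_algebra.
From mathcomp Require Import all_classical all_reals all_analysis.
From mathcomp Require Import measurable_realfun.
From mathcomp Require Import zify ring lra.
Set Implicit Arguments.
Unset Strict Implicit.
Unset Printing Implicit Defensive.
Import Order.TTheory GRing.Theory Num.Theory.
Import numFieldNormedType.Exports.
Local Open Scope classical_set_scope.
Local Open Scope ring_scope.

(** The surface is recovered from its gradient. For a conformal timelike
    surface the difference [X_tt - X_ss] is always orthogonal to the tangent
    plane, and its normal component is a multiple of the mean curvature; so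
    minimality is the wave equation [X_tt = X_ss] ([wave_equation]). This
    equation, with [X_ts = X_st], says that [X_t + k' X_s] is
    split-holomorphic.

    The function [gamma' + k' (W x gamma')] is split-holomorphic too. On the
    given interval of the real axis [gamma' = X_t] and [W x gamma' = N x X_t =
    X_s], so there both functions coincide. By the identity theorem they
    coincide on the whole region ([gradient_decomposition]). Comparing
    components, [X_t - Re gamma_t] and [X_s - Re gamma_s] are the imaginary
    and the real part of [W x gamma'], which means that the differential of [X
    - Re gamma] is [Im ((W x gamma') dw)]. Integrating along the path
    ([Rintegral_pullback]) and using that [X] and [Re gamma] agree at [t0]
    gives the formula, because [Re (k' c) = Im c].

    The identity theorem ([split_analytic_identity]) is where real analyticity
    enters. Split-holomorphy alone is a wave equation: values on an interval
    of the axis then only determine a function on the diamond spanned by that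
    interval. But [d_s f = k' d_t f] turns vanishing on the interval into
    vanishing of all derivatives there, and for an analytic function the set
    where all derivatives vanish is open and closed in the region.

    Most of the work is the underlying calculus of double power series: an
    analytic function has analytic partial derivatives ([expansion_diff]) and
    products of analytic functions are analytic ([expansionM]), which is
    needed because [W x gamma'] is built from products. All series are summed
    over squares, and all weights are absorbed by shrinking the radius. *)

(** * Sums over squares *)

Section SquareSums.
Context {R : realType}.
Implicit Types t T : nat -> nat -> R.

Definition square_sum t n : R := \sum_(i < n) \sum_(j < n) t i j.

Lemma square_sum_ext t T n :
  (forall i j, t i j = T i j) -> square_sum t n = square_sum T n.
Proof. by move=> e; do 2![apply: eq_bigr => ? _]. Qed.

Lemma square_sumD t T n :
  square_sum (fun i j => t i j + T i j) n = square_sum t n + square_sum T n.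
Proof.
by rewrite /square_sum -big_split /=; apply: eq_bigr => i _; rewrite big_split.
Qed.

Lemma square_sumZ c t n :
  square_sum (fun i j => c * t i j) n = c * square_sum t n.
Proof.
by rewrite /square_sum mulr_sumr; apply: eq_bigr => i _; rewrite mulr_sumr.
Qed.

Lemma square_sum_tr t n : square_sum (fun i j => t j i) n = square_sum t n.
Proof. by rewrite /square_sum exchange_big. Qed.

Lemma ler_square_sum t T n :
  (forall i j, t i j <= T i j) -> square_sum t n <= square_sum T n.
Proof. by move=> le; do 2![apply: ler_sum => ? _]. Qed.

Lemma ler_norm_square_sum t n :
  `|square_sum t n| <= square_sum (fun i j => `|t i j|) n.
Proof.
apply: le_trans (ler_norm_sum _ _ _) _; apply: ler_sum => i _.
exact: ler_norm_sum.
Qed.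

Lemma square_sumS t n :
  square_sum t n.+1 =
  square_sum t n + \sum_(i < n) t i n + \sum_(j < n.+1) t n j.
Proof.
rewrite /square_sum big_ord_recr /=; congr (_ + _).
by rewrite -big_split /=; apply: eq_bigr => i _; rewrite big_ord_recr.
Qed.

Lemma square_sum_cvg_ge0 t C : (forall i j, 0 <= t i j) ->
  (forall n, square_sum t n <= C) -> cvgn (square_sum t).
Proof.
move=> t0 tC; apply: nondecreasing_is_cvgn.
  apply/nondecreasing_seqP => n; rewrite square_sumS -addrA lerDl.
  by apply: addr_ge0; apply: sumr_ge0.
by exists C => _ [n _ <-].
Qed.

(** An absolutely bounded double series is a difference of two double series
    with nonnegative bounded partial sums, so its square partial sums
    converge. *)
Lemma square_sum_cvg t C :
  (forall n, square_sum (fun i j => `|t i j|) n <= C) -> cvgn (square_sum t).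
Proof.
move=> tC; have cn := square_sum_cvg_ge0 (fun i j => normr_ge0 (t i j)) tC.
rewrite (_ : square_sum t = square_sum (fun i j => t i j + `|t i j|)
    - square_sum (fun i j => `|t i j|)); last first.
  by apply/funext => n; rewrite !fctE square_sumD addrK.
apply: is_cvgB => //.
apply: (@square_sum_cvg_ge0 _ (C + C)) => [i j|n].
    by rewrite -lerBlDl sub0r -normrN ler_norm.
  rewrite square_sumD lerD//.
  by apply: le_trans (tC n); apply: ler_square_sum => i j; apply: ler_norm.
Qed.

(** The two sums differ by the last column [T' i n], which is controlled by
    the increments of the convergent absolute sums. *)
Lemma square_sum_shift T T' (C l : R) :
  (forall j, T 0%N j = 0) -> (forall i j, T i.+1 j = T' i j) ->
  (forall n, square_sum (fun i j => `|T' i j|) n <= C) ->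
  square_sum T' @ \oo --> l -> square_sum T @ \oo --> l.
Proof.
move=> T0 TS T'C cT'.
set A := square_sum (fun i j => `|T' i j|).
have cA : cvgn A by exact: square_sum_cvg_ge0 T'C.
rewrite -cvg_shiftS /=.
pose col n := \sum_(i < n) T' i n.
have -> : (fun n => square_sum T n.+1) = square_sum T' + col.
  apply/funext => n; rewrite /= !fctE /square_sum big_ord_recl.
  rewrite [X in X + _]big1 => [|j _]; last exact: T0.
  rewrite add0r -big_split; apply: eq_bigr => i _.
  by rewrite lift0 big_ord_recr TS; under eq_bigr do rewrite TS.
rewrite -[l]addr0; apply: cvgD => //.
apply/norm_cvg0P.
apply: (@squeeze_cvgr _ _ _ _ (cst 0) (fun n => A n.+1 - A n)) => //.
- near=> n; rewrite normr_ge0 /= /A lerBrDr square_sumS addrC -addrA lerD2l.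
  apply: le_trans (ler_norm_sum _ _ _) _; rewrite lerDl.
  exact: sumr_ge0.
- exact: cvg_cst.
- rewrite -(subrr (limn A)); apply: cvgB => //.
  by rewrite (cvg_shiftS A).
Unshelve. all: by end_near. Qed.

End SquareSums.

(** * Double power series *)

Section PowerSeries.
Context {R : realType}.
Implicit Types (a b : nat -> nat -> R) (f g : splitC R -> R) (z w : splitC R).

Definition power_sum a (x y : R) : nat -> R :=
  square_sum (fun i j => a i j * (x ^+ i * y ^+ j)).

Definition abs_coef a i j : R := `|a i j|.

(** [f] is near [z0] the sum of the double power series with coefficients [a].
    The absolute sums are bounded at [r] itself and not merely inside: this is
    a Cauchy estimate [`|a i j| <= C / r ^+ (i + j)] in summed form, and every
    weighted bound at a smaller radius is deduced from it. *)
Definition expansion f z0 r a : Prop :=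
  [/\ 0 < r, exists C, forall n, power_sum (abs_coef a) r r n <= C &
      forall z, `|z - z0| < r ->
        power_sum a (split_Re (z - z0)) (split_Im (z - z0)) @ \oo --> f z].

Definition analytic_at f z0 : Prop := exists r a, expansion f z0 r a.
Definition analytic (A : set (splitC R)) f : Prop :=
  forall z, A z -> analytic_at f z.

Lemma ler_split_Re z : `|split_Re z| <= `|z|.
Proof. by rewrite split_normE le_max lexx. Qed.

Lemma ler_split_Im z : `|split_Im z| <= `|z|.
Proof. by rewrite split_normE le_max lexx orbT. Qed.

Lemma ler_norm_term a (x y r : R) i j : `|x| <= r -> `|y| <= r ->
  `|a i j * (x ^+ i * y ^+ j)| <= abs_coef a i j * (r ^+ i * r ^+ j).
Proof.
move=> xr yr; have r0 : 0 <= r by exact: le_trans xr.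
rewrite !normrM !normrX; apply: ler_wpM2l; first exact: normr_ge0.
by apply: ler_pM; rewrite ?exprn_ge0// lerXn2r// nnegrE.
Qed.

Lemma ler_power_sum_abs a (x r : R) n : 0 <= x -> x <= r ->
  power_sum (abs_coef a) x x n <= power_sum (abs_coef a) r r n.
Proof.
move=> x0 xr; apply: ler_square_sum => i j.
apply: ler_wpM2l; first exact: normr_ge0.
by apply: ler_pM; rewrite ?exprn_ge0// lerXn2r// nnegrE// (le_trans x0).
Qed.

Lemma power_sum_tr a (x y : R) n :
  power_sum (fun i j => a j i) x y n = power_sum a y x n.
Proof.
rewrite /power_sum -square_sum_tr; apply: square_sum_ext => i j.
by rewrite [X in _ * X]mulrC.
Qed.

Lemma power_sum_cvg a (x y r C : R) : `|x| <= r -> `|y| <= r ->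
  (forall n, power_sum (abs_coef a) r r n <= C) -> cvgn (power_sum a x y).
Proof.
move=> xr yr aC; apply: (@square_sum_cvg _ _ C) => n.
by apply: le_trans (aC n); apply: ler_square_sum => i j; apply: ler_norm_term.
Qed.

Lemma expansion_le f z0 r r' a :
  0 < r' -> r' <= r -> expansion f z0 r a -> expansion f z0 r' a.
Proof.
move=> r0 rr [_ [C aC] fa]; split => //.
  by exists C => n; apply: le_trans (aC n); apply: ler_power_sum_abs => //;
    exact: ltW.
by move=> z zr; apply: fa; apply: lt_le_trans rr.
Qed.

Lemma power_sum0 a n : power_sum a 0 0 n.+1 = a 0%N 0%N.
Proof.
rewrite /power_sum /square_sum big_ord_recl big_ord_recl !expr0 !mulr1.
rewrite big1 ?addr0 => [|j _]; last by rewrite lift0 exprS mul0r !mulr0.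
rewrite big1 ?addr0// => i _; rewrite big1// => j _.
by rewrite lift0 exprS !mul0r mulr0.
Qed.

Lemma expansion_center f z0 r a : expansion f z0 r a -> f z0 = a 0%N 0%N.
Proof.
move=> [r0 _ /(_ z0)]; rewrite subrr normr0 => /(_ r0) /= c.
have : power_sum a 0 0 @ \oo --> a 0%N 0%N.
  rewrite -cvg_shiftS /=; under eq_fun do rewrite power_sum0.
  exact: cvg_cst.
exact: cvg_unique.
Qed.

Lemma expansionD f g z0 r a b : expansion f z0 r a -> expansion g z0 r b ->
  expansion (fun z => f z + g z) z0 r (fun i j => a i j + b i j).
Proof.
move=> [r0 [C aC] fa] [_ [D bD] gb]; split => //.
  exists (C + D) => n; apply: le_trans (lerD (aC n) (bD n)).
  rewrite -square_sumD; apply: ler_square_sum => i j; rewrite -mulrDl.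
  apply: ler_wpM2r; last exact: ler_normD.
  by rewrite mulr_ge0// exprn_ge0// ltW.
move=> z zr; rewrite (_ : power_sum _ _ _ =
    power_sum a (split_Re (z - z0)) (split_Im (z - z0))
    + power_sum b (split_Re (z - z0)) (split_Im (z - z0))).
  by apply: cvgD; [exact: fa|exact: gb].
apply/funext => n; rewrite !fctE -square_sumD.
by apply: square_sum_ext => i j; rewrite mulrDl.
Qed.

Lemma expansionZ c f z0 r a : expansion f z0 r a ->
  expansion (fun z => c * f z) z0 r (fun i j => c * a i j).
Proof.
move=> [r0 [C aC] fa]; split => //.
  exists (`|c| * C) => n; apply: le_trans (ler_wpM2l (normr_ge0 c) (aC n)).
  rewrite -square_sumZ; apply: ler_square_sum => i j.
  by rewrite /abs_coef normrM -mulrA.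
move=> z zr; rewrite (_ : power_sum _ _ _ =
    cst c * power_sum a (split_Re (z - z0)) (split_Im (z - z0))).
  by apply: cvgM; [exact: cvg_cst|exact: fa].
apply/funext => n; rewrite !fctE -square_sumZ.
by apply: square_sum_ext => i j; rewrite -mulrA.
Qed.

Lemma analyticD A f g : analytic A f -> analytic A g ->
  analytic A (fun z => f z + g z).
Proof.
move=> fA gA z Az; have [r [a fa]] := fA z Az; have [s [b gb]] := gA z Az.
have [r0 _ _] := fa; have [s0 _ _] := gb.
have m0 : 0 < Num.min r s by rewrite lt_min r0.
exists (Num.min r s), (fun i j => a i j + b i j).
apply: expansionD; [apply: expansion_le fa|apply: expansion_le gb] => //.
  by rewrite ge_min lexx.
by rewrite ge_min lexx orbT.
Qed.

Lemma analyticZ c A f : analytic A f -> analytic A (fun z => c * f z).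
Proof.
move=> fA z Az; have [r [a fa]] := fA z Az.
by exists r; eexists; exact: expansionZ fa.
Qed.

Lemma analyticB A f g : analytic A f -> analytic A g ->
  analytic A (fun z => f z - g z).
Proof.
move=> fA gA; have := analyticD fA (analyticZ (-1) gA).
by congr (analytic _ _); apply/funext => z; rewrite mulN1r.
Qed.

End PowerSeries.

(** * Taylor estimates for monomials *)

Section TermwiseDerivative.
Context {R : realType}.
Implicit Types (a : nat -> nat -> R) (f : splitC R -> R) (z w : splitC R).

Lemma ler_norm_expr (x r : R) n : `|x| <= r -> `|x ^+ n| <= r ^+ n.
Proof.
by move=> xr; rewrite normrX lerXn2r// nnegrE (le_trans _ xr).
Qed.

Lemma ler_norm_deriv_expr (x r : R) n : `|x| <= r ->
  r * `|n%:R * x ^+ n.-1| <= n%:R * r ^+ n.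
Proof.
move=> xr; have r0 : 0 <= r by exact: le_trans xr.
case: n => [|n]; first by rewrite !mul0r normr0 mulr0.
rewrite normrM normr_nat mulrCA ler_wpM2l// exprS ler_wpM2l//.
exact: ler_norm_expr.
Qed.

Lemma ler_norm_exprB (x w r : R) n : `|x| <= r -> `|w| <= r ->
  r * `|w ^+ n - x ^+ n| <= n%:R * r ^+ n * `|w - x|.
Proof.
move=> xr wr; have r0 : 0 <= r by exact: le_trans xr.
elim: n => [|n IH]; first by rewrite !expr0 subrr normr0 mulr0 !mul0r.
have -> : w ^+ n.+1 - x ^+ n.+1 = w * (w ^+ n - x ^+ n) + (w - x) * x ^+ n.
  by rewrite !exprS; ring.
apply: le_trans (ler_wpM2l r0 (ler_normD _ _)) _.
rewrite !normrM mulrDr.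
have -> : n.+1%:R * r ^+ n.+1 * `|w - x| =
  r * (n%:R * r ^+ n * `|w - x|) + r * (`|w - x| * r ^+ n).
  by rewrite exprS -natr1; ring.
apply: lerD; last by rewrite !ler_wpM2l// ler_norm_expr.
by rewrite mulrCA; apply: ler_pM => //; rewrite mulr_ge0.
Qed.

(** By induction on [n]: the remainder for [n.+1] is [w] times the remainder
    for [n] plus [(w - x) ^+ 2] times the derivative of the monomial.
    Multiplying by [r ^+ 2] avoids the exponent [n - 2], and the default value
    of [n.-1] at [n = 0] is harmless since it comes with the factor [n%:R]. *)
Lemma ler_norm_expr_taylor (x w r : R) n : `|x| <= r -> `|w| <= r ->
  r ^+ 2 * `|w ^+ n - x ^+ n - (w - x) * (n%:R * x ^+ n.-1)|
    <= n%:R ^+ 2 * r ^+ n * `|w - x| ^+ 2.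
Proof.
move=> xr wr; have r0 : 0 <= r by exact: le_trans xr.
elim: n => [|n IH].
  by rewrite !expr0 subrr mul0r mulr0 subrr normr0 mulr0 expr0n !mul0r.
have -> : w ^+ n.+1 - x ^+ n.+1 - (w - x) * (n.+1%:R * x ^+ n.+1.-1) =
  w * (w ^+ n - x ^+ n - (w - x) * (n%:R * x ^+ n.-1))
  + (w - x) ^+ 2 * (n%:R * x ^+ n.-1).
  by case: n {IH} => [|n]; rewrite /= -?natr1 !exprS ?expr0; ring.
apply: le_trans (ler_wpM2l (exprn_ge0 2 r0) (ler_normD _ _)) _.
rewrite !(normrM, normrX) mulrDr.
apply: (@le_trans _ _ (r * (n%:R ^+ 2 * r ^+ n * `|w - x| ^+ 2)
  + r * (`|w - x| ^+ 2 * (n%:R * r ^+ n)))); last first.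
  rewrite (exprS r n) -natr1 -subr_ge0.
  have -> : (n%:R + 1) ^+ 2 * (r * r ^+ n) * `|w - x| ^+ 2 -
    (r * (n%:R ^+ 2 * r ^+ n * `|w - x| ^+ 2) +
     r * (`|w - x| ^+ 2 * (n%:R * r ^+ n)))
    = (n%:R + 1) * (r * r ^+ n * `|w - x| ^+ 2) by ring.
  by rewrite !mulr_ge0 ?exprn_ge0 ?addr_ge0.
apply: lerD.
  rewrite mulrCA; apply: ler_pM => //.
  by rewrite mulr_ge0 ?exprn_ge0.
have -> : r ^+ 2 * (`|w - x| ^+ 2 * (`|n%:R| * `|x| ^+ n.-1)) =
  r * (`|w - x| ^+ 2 * (r * (`|n%:R| * `|x| ^+ n.-1))) by ring.
rewrite -[`|x| ^+ _]normrX -normrM !ler_wpM2l ?exprn_ge0//.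
exact: ler_norm_deriv_expr.
Qed.

(** The remainder in two variables is the one in the first variable times [y'
    ^+ j], plus [x ^+ i] times the one in the second variable, plus a product
    of two first order increments. *)
Lemma ler_norm_monomial_taylor (x x' y y' r H : R) i j :
  `|x| <= r -> `|x'| <= r -> `|y| <= r -> `|y'| <= r ->
  `|x' - x| <= H -> `|y' - y| <= H ->
  r ^+ 2 * `|x' ^+ i * y' ^+ j - x ^+ i * y ^+ j
     - (x' - x) * (i%:R * x ^+ i.-1 * y ^+ j)
     - (y' - y) * (j%:R * y ^+ j.-1 * x ^+ i)|
    <= (i + j)%:R ^+ 2 * (r ^+ i * r ^+ j) * H ^+ 2.
Proof.
move=> xr x'r yr y'r xH yH; have r0 : 0 <= r by exact: le_trans xr.
have H0 : 0 <= H by exact: le_trans xH.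
pose A := x' ^+ i - x ^+ i - (x' - x) * (i%:R * x ^+ i.-1).
pose B := y' ^+ j - y ^+ j - (y' - y) * (j%:R * y ^+ j.-1).
pose D := y' ^+ j - y ^+ j.
have -> : x' ^+ i * y' ^+ j - x ^+ i * y ^+ j
     - (x' - x) * (i%:R * x ^+ i.-1 * y ^+ j)
     - (y' - y) * (j%:R * y ^+ j.-1 * x ^+ i) =
  A * y' ^+ j + (x' - x) * (i%:R * x ^+ i.-1) * D + x ^+ i * B.
  by rewrite /A /B /D; ring.
have ri := exprn_ge0 i r0; have rj := exprn_ge0 j r0.
have sq (u : R) : `|u| <= H -> `|u| ^+ 2 <= H ^+ 2.
  by move=> uH; rewrite lerXn2r ?nnegrE.
have hA : r ^+ 2 * `|A| <= i%:R ^+ 2 * r ^+ i * H ^+ 2.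
  apply: le_trans (ler_norm_expr_taylor i xr x'r) _.
  by rewrite ler_wpM2l ?sq// mulr_ge0 ?exprn_ge0.
have hB : r ^+ 2 * `|B| <= j%:R ^+ 2 * r ^+ j * H ^+ 2.
  apply: le_trans (ler_norm_expr_taylor j yr y'r) _.
  by rewrite ler_wpM2l ?sq// mulr_ge0 ?exprn_ge0.
have hD : r * `|D| <= j%:R * r ^+ j * H.
  apply: le_trans (ler_norm_exprB j yr y'r) _.
  by rewrite ler_wpM2l// mulr_ge0.
apply: le_trans (ler_wpM2l (exprn_ge0 2 r0) (ler_normD _ _)) _.
apply: (@le_trans _ _ (i%:R ^+ 2 * r ^+ i * H ^+ 2 * r ^+ j
  + H * (i%:R * r ^+ i) * (j%:R * r ^+ j * H)
  + r ^+ i * (j%:R ^+ 2 * r ^+ j * H ^+ 2))); last first.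
  rewrite -subr_ge0 natrD.
  rewrite [X in 0 <= X](_ : _ =
    i%:R * j%:R * (r ^+ i * r ^+ j * H ^+ 2)); last by ring.
  by rewrite !mulr_ge0 ?exprn_ge0.
rewrite mulrDr lerD//; last first.
  by rewrite normrM mulrCA; apply: ler_pM => //;
    rewrite ?ler_norm_expr ?mulr_ge0 ?exprn_ge0.
apply: le_trans (ler_wpM2l (exprn_ge0 2 r0) (ler_normD _ _)) _.
rewrite mulrDr lerD//.
  by rewrite normrM mulrA; apply: ler_pM => //;
    rewrite ?ler_norm_expr ?mulr_ge0 ?exprn_ge0.
rewrite !normrM; rewrite -!normrM (_ : r ^+ 2 * _ =
  `|x' - x| * (r * `|i%:R * x ^+ i.-1|) * (r * `|D|)); last first.
  by rewrite !normrM; ring.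
apply: ler_pM => //; rewrite ?mulr_ge0//.
by apply: ler_pM => //; rewrite ?mulr_ge0// ler_norm_deriv_expr.
Qed.

(** Since [m ^ 2 <= 4 ^ m], passing from radius [r] to [r / 4] absorbs a
    quadratic weight, so no series with weights has to be summed. *)
Lemma quarter_radius_weight (r : R) i j : 0 <= r ->
  (i + j)%:R ^+ 2 * ((r / 4) ^+ i * (r / 4) ^+ j) <= r ^+ i * r ^+ j.
Proof.
move=> r0; rewrite -!exprD expr_div_n mulrCA.
rewrite ler_piMr ?exprn_ge0// ler_pdivrMr ?exprn_gt0// mul1r.
by rewrite -!natrX ler_nat -[4%N]/(2 ^ 2)%N expnAC leq_exp2r// ltnW// ltn_expl.
Qed.

Definition d_coef1 a : nat -> nat -> R := fun i j => i.+1%:R * a i.+1 j.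
Definition d_coef2 a : nat -> nat -> R := fun i j => j.+1%:R * a i j.+1.

Lemma square_sum_shift_le (t : nat -> nat -> R) n : (forall i j, 0 <= t i j) ->
  square_sum (fun i j => t i.+1 j) n <= square_sum t n.+1.
Proof.
move=> t0; rewrite /square_sum big_ord_recl -[leLHS]add0r lerD ?sumr_ge0//.
apply: ler_sum => i _; rewrite big_ord_recr /= [bump _ _]add1n.
by rewrite lerDl.
Qed.

Lemma d_coef1_bound a (r C : R) : 0 < r ->
  (forall n, power_sum (abs_coef a) r r n <= C) ->
  forall n, power_sum (abs_coef (d_coef1 a)) (r / 4) (r / 4) n <= C / (r / 4).
Proof.
move=> r0 aC n; have q0 : 0 < r / 4 by rewrite divr_gt0.
rewrite ler_pdivlMr// mulrC -square_sumZ; apply: le_trans (aC n.+1).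
pose t i j := i%:R * `|a i j| * ((r / 4) ^+ i * (r / 4) ^+ j).
apply: (@le_trans _ _ (square_sum t n.+1)).
  have t0 i j : 0 <= t i j by rewrite !mulr_ge0 ?exprn_ge0// ltW.
  apply: le_trans (square_sum_shift_le n t0); apply: ler_square_sum => i j.
  by rewrite /t /abs_coef /d_coef1 normrM normr_nat exprS le_eqVlt; apply/orP;
    left; apply/eqP; ring.
apply: ler_square_sum => i j; rewrite /t mulrAC mulrC ler_wpM2l//.
apply: le_trans (quarter_radius_weight i j (ltW r0)).
apply: ler_wpM2r; first by rewrite !mulr_ge0 ?exprn_ge0// ltW.
rewrite -natrX ler_nat (leq_trans (leq_addr j i))//.
by case: (i + j)%N => // m; rewrite expnS expn1 leq_pmulr.
Qed.

Lemma d_coef2_bound a (r C : R) : 0 < r ->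
  (forall n, power_sum (abs_coef a) r r n <= C) ->
  forall n, power_sum (abs_coef (d_coef2 a)) (r / 4) (r / 4) n <= C / (r / 4).
Proof.
move=> r0 aC n; rewrite -(power_sum_tr (abs_coef (d_coef2 a))).
by apply: (@d_coef1_bound (fun i j => a j i)) => // m;
  rewrite (power_sum_tr (abs_coef a)).
Qed.

End TermwiseDerivative.

(** * Termwise differentiation *)

Section Frechet.
Context {R : realType}.
Implicit Types (a : nat -> nat -> R) (f : splitC R -> R) (z w : splitC R).

Definition lin_form (p q : R) (h : splitC R) : R :=
  p * split_Re h + q * split_Im h.

Lemma lin_form_is_linear p q : linear (lin_form p q : splitC R -> R^o).
Proof. by move=> c h k; rewrite /lin_form /= /GRing.scale /=; ring. Qed.

HB.instance Definition _ p q := GRing.isLinear.Build R (splitC R) R^o _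
  (lin_form p q) (lin_form_is_linear p q).

Lemma lin_form_continuous p q z :
  lin_form p q w @[w --> z] --> lin_form p q z.
Proof.
apply/(@cvgrPdist_le _ _ _ (nbhs z)) => e e0.
have m0 : 0 < `|p| + `|q| + 1 by rewrite ltr_pwDr// addr_ge0.
apply/nbhs_normP; exists (e / (`|p| + `|q| + 1)); first exact: divr_gt0.
move=> w /= /ltW; rewrite /ball_ /= => zw.
rewrite (_ : _ - _ = lin_form p q (z - w)); last by rewrite /lin_form /=; ring.
rewrite /lin_form; apply: le_trans (ler_normD _ _) _.
apply: (@le_trans _ _ ((`|p| + `|q| + 1) * `|z - w|)).
  rewrite !normrM !mulrDl -[leLHS]addr0 !lerD ?mulr_ge0//.
    by rewrite ler_wpM2l// ler_split_Re.
  by rewrite ler_wpM2l// ler_split_Im.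
by rewrite mulrC -ler_pdivlMr.
Qed.

(** A quadratic remainder determines the differential, and the partial
    derivatives are its values at the two basis vectors [1] and ['k]. *)
Lemma frechet_diff f z p q (C r : R) : 0 < r ->
  (forall w, `|w - z| < r ->
    `|f w - f z - lin_form p q (w - z)| <= C * `|w - z| ^+ 2) ->
  [/\ differentiable f z, d_t f z = p & d_s f z = q].
Proof.
move=> r0 fC.
have fo : f \o shift z = cst (f z) + lin_form p q +o_ 0 id.
  apply/eqaddoP => _/posnumP[e].
  have m0 : 0 < `|C| + 1 by rewrite ltr_pwDr.
  near=> h.
  rewrite /= !fctE.
  have hr : `|h| < r by near: h; exact: nbhs0_lt.
  have he : `|h| <= e%:num / (`|C| + 1).
    by near: h; apply: nbhs0_le; rewrite divr_gt0.
  have hz : `|h + z - z| < r by rewrite addrK.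
  have := fC _ hz; rewrite addrK => hC.
  rewrite opprD addrA; apply: le_trans hC _.
  rewrite expr2 mulrA ler_wpM2r//.
  apply: (@le_trans _ _ ((`|C| + 1) * `|h|)).
    by rewrite ler_wpM2r// (le_trans (ler_norm _))// lerDl.
  by rewrite mulrC -ler_pdivlMr.
have df := diff_unique (@lin_form_continuous p q) fo.
have fd : differentiable f z.
  by apply/diff_locallyP; rewrite df; split => //; exact: lin_form_continuous.
split => //; rewrite /d_t /d_s deriveE// df.
  by change (p * 1 + q * 0 = p); ring.
by change (p * 0 + q * 1 = q); ring.
Unshelve. all: by end_near. Qed.

(** Termwise differentiation. The monomial Taylor estimates, summed against
    the coefficients, leave a quadratic remainder; the weights [(i + j) ^ 2]
    are absorbed by the smaller radius. This holds at every point near [z0],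
    not only at [z0], so the derivative is again the sum of a series around
    [z0]. *)
Lemma expansion_diff f z0 r a z : expansion f z0 r a -> `|z - z0| < r / 4 ->
  let da i := power_sum i (split_Re (z - z0)) (split_Im (z - z0)) in
  [/\ differentiable f z, da (d_coef1 a) @ \oo --> d_t f z &
      da (d_coef2 a) @ \oo --> d_s f z].
Proof.
move=> [r0 [C aC] fa] zr da.
have q0 : 0 < r / 4 by rewrite divr_gt0.
have qr : r / 4 < r by rewrite ltr_pdivrMr// ltr_pMr// ltr1n.
pose x := split_Re (z - z0); pose y := split_Im (z - z0).
have xq : `|x| <= r / 4 by rewrite (le_trans (ler_split_Re _))// ltW.
have yq : `|y| <= r / 4 by rewrite (le_trans (ler_split_Im _))// ltW.
have b1 := d_coef1_bound r0 aC.
have b2 := d_coef2_bound r0 aC.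
have c1 : cvgn (da (d_coef1 a)) by exact: power_sum_cvg b1.
have c2 : cvgn (da (d_coef2 a)) by exact: power_sum_cvg b2.
pose p := limn (da (d_coef1 a)); pose q := limn (da (d_coef2 a)).
have abs_le (x' y' : R) (b : nat -> nat -> R) D :
    `|x'| <= r / 4 -> `|y'| <= r / 4 ->
    (forall n, power_sum (abs_coef b) (r / 4) (r / 4) n <= D) ->
    forall n, square_sum (fun i j => `|b i j * (x' ^+ i * y' ^+ j)|) n <= D.
  move=> xr yr bD n; apply: le_trans (bD n).
  by apply: ler_square_sum => i j; exact: ler_norm_term.
(* The differentiated series before the index shift: its partial sums run over
   the same squares as those of [f], hence can be combined with them. *)
pose T1 i j := a i j * (i%:R * x ^+ i.-1 * y ^+ j).
pose T2 i j := a i j * (j%:R * y ^+ j.-1 * x ^+ i).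
have cT1 : square_sum T1 @ \oo --> p.
  apply: (square_sum_shift _ _ (abs_le _ _ _ _ xq yq b1)) => //.
    by move=> j; rewrite /T1 !mul0r mulr0.
  by move=> i j; rewrite /T1 /d_coef1 /=; ring.
have cT2 : square_sum T2 @ \oo --> q.
  rewrite (_ : square_sum T2 = square_sum (fun i j => T2 j i)); last first.
    by apply/funext => n; rewrite square_sum_tr.
  pose S j i := d_coef2 a i j * (x ^+ i * y ^+ j).
  have SE : square_sum S = da (d_coef2 a).
    by apply/funext => n; rewrite -square_sum_tr.
  apply: (@square_sum_shift _ _ S (C / (r / 4))).
  - by move=> j; rewrite /T2 !mul0r mulr0.
  - by move=> i j; rewrite /T2 /S /d_coef2 /=; ring.
  - move=> n; rewrite -square_sum_tr.
    exact: abs_le xq yq b2 n.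
  - by rewrite SE.
suff [fd -> ->] : [/\ differentiable f z, d_t f z = p & d_s f z = q] by [].
apply: (@frechet_diff _ _ _ _ (C / (r / 4) ^+ 2) (r / 4 - `|z - z0|)).
  by rewrite subr_gt0.
move=> w wz; set H := `|w - z|.
have H20 : 0 <= H ^+ 2 by exact: exprn_ge0 (normr_ge0 _).
have wr : `|w - z0| < r / 4.
  by rewrite -(subrKA z) (le_lt_trans (ler_normD _ _))// -ltrBrDr.
pose x' := split_Re (w - z0); pose y' := split_Im (w - z0).
have x'q : `|x'| <= r / 4 by rewrite (le_trans (ler_split_Re _))// ltW.
have y'q : `|y'| <= r / 4 by rewrite (le_trans (ler_split_Im _))// ltW.
have dx : split_Re (w - z) = x' - x by rewrite /x' /x /=; ring.
have dy : split_Im (w - z) = y' - y by rewrite /y' /y /=; ring.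
have xH : `|x' - x| <= H by rewrite -dx ler_split_Re.
have yH : `|y' - y| <= H by rewrite -dy ler_split_Im.
pose U i j := a i j * (x' ^+ i * y' ^+ j - x ^+ i * y ^+ j
     - (x' - x) * (i%:R * x ^+ i.-1 * y ^+ j)
     - (y' - y) * (j%:R * y ^+ j.-1 * x ^+ i)).
have cU : square_sum U @ \oo --> f w - f z - lin_form p q (w - z).
  rewrite (_ : square_sum U = power_sum a x' y' - power_sum a x y
    - (cst (x' - x) * square_sum T1 + cst (y' - y) * square_sum T2)).
    rewrite /lin_form dx dy ![_ * (_ - _)]mulrC.
    by apply: cvgB; [apply: cvgB; apply: fa; exact: lt_trans qr|
      apply: cvgD; apply: cvgM => //; exact: cvg_cst].
  apply/funext => n; rewrite !fctE -!square_sumZ -square_sumD.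
  rewrite -![- square_sum _ _]mulN1r -!square_sumZ -!square_sumD.
  by apply: square_sum_ext => i j; rewrite /U /T1 /T2; ring.
have cN : `|square_sum U n| @[n --> \oo] -->
    `|f w - f z - lin_form p q (w - z)|.
  exact: cvg_norm.
rewrite -(cvg_lim _ cN)//; apply: limr_le.
  by apply/cvg_ex; eexists; exact: cN.
near=> n.
apply: le_trans (ler_norm_square_sum _ _) _.
rewrite mulrAC ler_pdivlMr ?exprn_gt0// mulrC -square_sumZ.
apply: (@le_trans _ _ (H ^+ 2 * power_sum (abs_coef a) r r n)).
  rewrite -square_sumZ; apply: ler_square_sum => i j.
  rewrite normrM mulrCA [leRHS]mulrCA ler_wpM2l//.
  apply: le_trans (ler_norm_monomial_taylor i j xq x'q yq y'q xH yH) _.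
  rewrite [leRHS]mulrC; apply: ler_wpM2r; first exact: H20.
  exact: quarter_radius_weight (ltW r0).
by rewrite mulrC ler_wpM2r.
Unshelve. all: by end_near. Qed.

Lemma expansion_dt f z0 r a : expansion f z0 r a ->
  expansion (d_t f) z0 (r / 4) (d_coef1 a).
Proof.
move=> fa; have [r0 [C aC] _] := fa; split; first by rewrite divr_gt0.
  by exists (C / (r / 4)) => n; exact: d_coef1_bound.
by move=> z zr; have [] := expansion_diff fa zr.
Qed.

Lemma expansion_ds f z0 r a : expansion f z0 r a ->
  expansion (d_s f) z0 (r / 4) (d_coef2 a).
Proof.
move=> fa; have [r0 [C aC] _] := fa; split; first by rewrite divr_gt0.
  by exists (C / (r / 4)) => n; exact: d_coef2_bound.
by move=> z zr; have [] := expansion_diff fa zr.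
Qed.

Variable A : set (splitC R).

Lemma analytic_differentiable f z : analytic A f -> A z -> differentiable f z.
Proof.
move=> fA Az; have [r [a fa]] := fA z Az.
have [r0 _ _] := fa.
have zr : `|z - z| < r / 4 by rewrite subrr normr0 divr_gt0.
by have [] := expansion_diff fa zr.
Qed.

Lemma analytic_dt f : analytic A f -> analytic A (d_t f).
Proof.
move=> fA z Az; have [r [a fa]] := fA z Az.
by exists (r / 4), (d_coef1 a); exact: expansion_dt.
Qed.

Lemma analytic_ds f : analytic A f -> analytic A (d_s f).
Proof.
move=> fA z Az; have [r [a fa]] := fA z Az.
by exists (r / 4), (d_coef2 a); exact: expansion_ds.
Qed.

(** Both mixed derivatives at a point are the coefficient [a 1 1] there. *)
Lemma analytic_dts f z : analytic A f -> A z -> d_s (d_t f) z = d_t (d_s f) z.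
Proof.
move=> fA Az; have [r [a fa]] := fA z Az.
rewrite (expansion_center (expansion_ds (expansion_dt fa))).
by rewrite (expansion_center (expansion_dt (expansion_ds fa))).
Qed.

End Frechet.

(** * Products of power series *)

Section CauchyProduct.
Context {R : realType}.
Implicit Types (a b : nat -> nat -> R) (f g : splitC R -> R) (z w : splitC R).

(** The antidiagonals [k + l = i < n] fill the triangle [k + l < n]; it is cut
    out of the square by an indicator, so that it can be compared with a
    product of sums over the same square. *)
Lemma sum_antidiagonal (G : nat -> nat -> R) n :
  \sum_(i < n) \sum_(k < i.+1) G k (i - k)%N =
  \sum_(k < n) \sum_(l < n) (k + l < n)%N%:R * G k l.
Proof.
transitivity (\sum_(i < n) \sum_(k < n) \sum_(l < n)
    (if (k + l == i)%N then G k l else 0)).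
  apply: eq_bigr => i _.
  rewrite (big_ord_widen _ (fun k => G k (i - k)%N) (ltn_ord i)) big_mkcond.
  apply: eq_bigr => k _; rewrite ltnS; case: leqP => [ki|ik]; last first.
    rewrite big1// => l _; case: eqP => // kl.
    by move: ik; rewrite -kl ltnNge leq_addr.
  have lt : (i - k < n)%N by rewrite (leq_ltn_trans (leq_subr _ _)).
  rewrite (bigD1 (Ordinal lt))//= subnKC// eqxx big1 ?addr0// => l /eqP nl.
  case: eqP => // kl; case: nl; apply: val_inj => /=.
  by rewrite -kl addKn.
rewrite exchange_big; apply: eq_bigr => k _.
rewrite exchange_big; apply: eq_bigr => l _.
case: ltnP => [lt|ge].
  rewrite mul1r (bigD1 (Ordinal lt))//= eqxx big1 ?addr0// => i /eqP ni.
  by case: eqP => // kl; case: ni; apply: val_inj.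
rewrite mul0r big1// => i _; case: eqP => // kl.
by move: (ltn_ord i); rewrite -kl ltnNge ge.
Qed.

Definition cauchy_coef a b i j : R :=
  \sum_(k < i.+1) \sum_(l < j.+1) a k l * b (i - k)%N (j - l)%N.

Definition term a (x y : R) i j : R := a i j * (x ^+ i * y ^+ j).

Definition in_square n k k' l l' : R := ((k + k' < n) && (l + l' < n))%N%:R.

Lemma power_sum_cauchy a b x y n :
  power_sum (cauchy_coef a b) x y n =
  \sum_(k < n) \sum_(k' < n) \sum_(l < n) \sum_(l' < n)
    in_square n k k' l l' * (term a x y k l * term b x y k' l').
Proof.
pose G k k' l l' := term a x y k l * term b x y k' l'.
transitivity (\sum_(i < n) \sum_(k < i.+1) \sum_(j < n) \sum_(l < j.+1)
    G k (i - k)%N l (j - l)%N).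
  apply: eq_bigr => i _; rewrite exchange_big; apply: eq_bigr => j _.
  rewrite mulr_suml; apply: eq_bigr => k _.
  rewrite mulr_suml; apply: eq_bigr => l _.
  rewrite /G /term -[in x ^+ i](subnKC (_ : k <= i)%N) -1?ltnS//.
  by rewrite -[in y ^+ j](subnKC (_ : l <= j)%N) -1?ltnS// !exprD; ring.
rewrite (sum_antidiagonal (fun k k' =>
  \sum_(j < n) \sum_(l < j.+1) G k k' l (j - l)%N)).
apply: eq_bigr => k _; apply: eq_bigr => k' _.
rewrite (sum_antidiagonal (G k k')) mulr_sumr; apply: eq_bigr => l _.
rewrite mulr_sumr; apply: eq_bigr => l' _.
by rewrite mulrA /in_square -mulnb natrM.
Qed.

Lemma power_sum_prod a b x y n :
  power_sum a x y n * power_sum b x y n =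
  \sum_(k < n) \sum_(k' < n) \sum_(l < n) \sum_(l' < n)
    term a x y k l * term b x y k' l'.
Proof.
rewrite /power_sum /square_sum mulr_suml; apply: eq_bigr => k _.
rewrite [RHS]exchange_big mulr_suml; apply: eq_bigr => l _.
rewrite mulr_sumr; apply: eq_bigr => k' _.
by rewrite mulr_sumr.
Qed.

Lemma term_abs_ge0 a (r : R) k l : 0 <= r -> 0 <= term (abs_coef a) r r k l.
Proof.
by move=> r0; rewrite mulr_ge0 ?mulr_ge0 ?exprn_ge0 ?normr_ge0.
Qed.

Lemma cauchy_coef_bound a b (r C D : R) : 0 <= r ->
  (forall n, power_sum (abs_coef a) r r n <= C) ->
  (forall n, power_sum (abs_coef b) r r n <= D) ->
  forall n, power_sum (abs_coef (cauchy_coef a b)) r r n <= C * D.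
Proof.
move=> r0 aC bD n.
have t0 c k l := term_abs_ge0 c k l r0.
have s0 c : 0 <= power_sum (abs_coef c) r r n.
  by apply: sumr_ge0 => i _; apply: sumr_ge0 => j _; exact: t0.
apply: le_trans (ler_pM (s0 a) (s0 b) (aC n) (bD n)).
apply: (@le_trans _ _
  (power_sum (cauchy_coef (abs_coef a) (abs_coef b)) r r n)).
  apply: ler_square_sum => i j; apply: ler_wpM2r.
    by rewrite mulr_ge0 ?exprn_ge0.
  rewrite /abs_coef /cauchy_coef; apply: le_trans (ler_norm_sum _ _ _) _.
  apply: ler_sum => k _; apply: le_trans (ler_norm_sum _ _ _) _.
  by apply: ler_sum => l _; rewrite normrM.
rewrite power_sum_cauchy power_sum_prod; do 4![apply: ler_sum => ? _].
rewrite -[leRHS]mul1r; apply: ler_wpM2r; first exact: mulr_ge0.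
by rewrite /in_square lern1 leq_b1.
Qed.

(** The square partial sums of the Cauchy product omit from the product of the
    partial sums only terms of total degree at least [n]; at half the radius
    these are bounded by [2 ^- n] times a convergent majorant. *)
Lemma power_sum_cauchy_dist a b (x y r C D : R) : 0 <= r ->
  (forall n, power_sum (abs_coef a) r r n <= C) ->
  (forall n, power_sum (abs_coef b) r r n <= D) ->
  `|x| <= r / 2 -> `|y| <= r / 2 -> forall n,
  `|power_sum a x y n * power_sum b x y n - power_sum (cauchy_coef a b) x y n|
    <= 2^-1 ^+ n * (C * D).
Proof.
move=> r0 aC bD xr yr n.
have t0 c k l := term_abs_ge0 c k l r0.
have s0 c : 0 <= power_sum (abs_coef c) r r n.
  by apply: sumr_ge0 => i _; apply: sumr_ge0 => j _; exact: t0.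
apply: le_trans (ler_wpM2l _ (ler_pM (s0 a) (s0 b) (aC n) (bD n))); last first.
  by rewrite exprn_ge0.
rewrite power_sum_cauchy !power_sum_prod -sumrB mulr_sumr.
apply: le_trans (ler_norm_sum _ _ _) _; apply: ler_sum => k _.
rewrite -sumrB mulr_sumr.
apply: le_trans (ler_norm_sum _ _ _) _; apply: ler_sum => k' _.
rewrite -sumrB mulr_sumr.
apply: le_trans (ler_norm_sum _ _ _) _; apply: ler_sum => l _.
rewrite -sumrB mulr_sumr.
apply: le_trans (ler_norm_sum _ _ _) _; apply: ler_sum => l' _.
rewrite /in_square; case: (boolP (_ && _)) => [_|out].
  rewrite mul1r subrr normr0.
  by apply: mulr_ge0; [exact: exprn_ge0|exact: mulr_ge0].
rewrite mul0r subr0.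
have half c i j : `|term c x y i j| <=
    2^-1 ^+ (i + j) * term (abs_coef c) r r i j.
  apply: le_trans (ler_norm_term _ _ _ xr yr) _.
  by rewrite /term !expr_div_n -exprVn exprD le_eqVlt; apply/orP; left;
    apply/eqP; rewrite -!exprVn; ring.
rewrite normrM; apply: le_trans (ler_pM _ _ (half _ _ _) (half _ _ _)) _ => //.
rewrite mulrACA -exprD; apply: ler_wpM2r; first exact: mulr_ge0.
apply: ler_wiXn2l; rewrite ?invr_ge0 ?invf_le1 ?ler1n//.
by move: out; rewrite negb_and -!leqNgt; lia.
Qed.

Lemma expansionM f g z0 r a b : expansion f z0 r a -> expansion g z0 r b ->
  expansion (fun z => f z * g z) z0 (r / 2) (cauchy_coef a b).
Proof.
move=> fa gb; have [r0 [C aC] fl] := fa; have [_ [D bD] gl] := gb.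
have h0 : 0 < r / 2 by rewrite divr_gt0.
have hr : r / 2 < r by rewrite ltr_pdivrMr// ltr_pMr// ltr1n.
split => // [|z zr].
  exists (C * D) => n.
  apply: le_trans (cauchy_coef_bound (ltW r0) aC bD n).
  by apply: ler_power_sum_abs; exact: ltW.
set x := split_Re _; set y := split_Im _.
have xr : `|x| <= r / 2 by rewrite (le_trans (ler_split_Re _))// ltW.
have yr : `|y| <= r / 2 by rewrite (le_trans (ler_split_Im _))// ltW.
pose e n := power_sum a x y n * power_sum b x y n
  - power_sum (cauchy_coef a b) x y n.
have e0 : e @ \oo --> (0 : R).
  apply/norm_cvg0P.
  apply: (@squeeze_cvgr _ _ _ _ (cst 0) (fun n => 2^-1 ^+ n * (C * D))).
  - near=> n; rewrite normr_ge0 /=.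
    exact: power_sum_cauchy_dist (ltW r0) aC bD xr yr n.
  - exact: cvg_cst.
  - rewrite -[X in _ --> X](mul0r (C * D)); apply: cvgM; last exact: cvg_cst.
    by apply: cvg_expr; rewrite ger0_norm ?invf_lt1 ?ltr1n.
rewrite (_ : power_sum (cauchy_coef a b) x y =
    power_sum a x y * power_sum b x y - e); last first.
  by apply/funext => n; rewrite !fctE /e; ring.
rewrite -[X in _ --> X]subr0; apply: cvgB => //.
by apply: cvgM; [apply: fl|apply: gl]; exact: lt_trans hr.
Unshelve. all: by end_near. Qed.

Lemma analyticM A f g : analytic A f -> analytic A g ->
  analytic A (fun z => f z * g z).
Proof.
move=> fA gA z Az; have [r [a fa]] := fA z Az; have [s [b gb]] := gA z Az.
have [r0 _ _] := fa; have [s0 _ _] := gb.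
have m0 : 0 < Num.min r s by rewrite lt_min r0.
exists (Num.min r s / 2), (cauchy_coef a b).
apply: expansionM; [apply: expansion_le fa|apply: expansion_le gb] => //.
  by rewrite ge_min lexx.
by rewrite ge_min lexx orbT.
Qed.

End CauchyProduct.

(** * Split-holomorphic functions and the identity theorem *)

Section SplitAnalytic.
Context {R : realType}.
Implicit Types (A : set (splitC R)) (u v : splitC R -> R).
Implicit Types (f g : splitC R -> splitC R) (z w : splitC R).

Lemma near_splitP (P : splitC R -> Prop) z :
  (\forall w \near z, P w) <->
  exists2 e : R, 0 < e & forall w, `|w - z| < e -> P w.
Proof.
split=> [/nbhs_normP[e /= e0 eP]|[e e0 eP]].
  by exists e => // w we; apply: eP; rewrite /ball_ /= distrC.
by apply/nbhs_normP; exists e => //= w; rewrite /ball_ /= distrC; apply: eP.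
Qed.

Lemma open_near A z : open A -> A z -> \forall w \near z, A w.
Proof. by move=> oA Az; exact: open_nbhs_nbhs. Qed.

Lemma dt_eq_open A u v : open A -> (forall z, A z -> u z = v z) ->
  forall z, A z -> d_t u z = d_t v z.
Proof.
move=> oA uv z Az; apply: near_eq_derive.
by apply: filterS (open_near oA Az) => w; exact: uv.
Qed.

Lemma ds_eq_open A u v : open A -> (forall z, A z -> u z = v z) ->
  forall z, A z -> d_s u z = d_s v z.
Proof.
move=> oA uv z Az; apply: near_eq_derive.
by apply: filterS (open_near oA Az) => w; exact: uv.
Qed.

Lemma analytic_derivable A u z h : analytic A u -> A z -> derivable u z h.
Proof.
by move=> uA Az; apply: diff_derivable; exact: analytic_differentiable uA Az.
Qed.

Lemma analytic_continuous A u z : analytic A u -> A z ->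
  u w @[w --> z] --> u z.
Proof.
move=> uA Az; apply: differentiable_continuous.
exact: analytic_differentiable uA Az.
Qed.

(** The restriction of [d_t] to the real axis is an ordinary derivative, so it
    only sees the values on the axis. *)
Lemma dt_real u (t : R) : d_t u t%:SC = 'D_1 (fun x : R => u x%:SC) t.
Proof.
rewrite /d_t /derive.
have -> : (fun h : R => h^-1 *: ((u \o shift t%:SC) (h *: 1) - u t%:SC)) =
  (fun h : R => h^-1 *: (((fun x : R => u x%:SC) \o shift t) (h *: 1)
                         - u t%:SC)); last by [].
apply/funext => h /=; congr (_ *: (u _ - _)).
by congr SplitC => /=; rewrite ?mulr0 ?addr0.
Qed.

Lemma dt_eq_real u v (a b : R) :
  (forall t : R, a < t < b -> u t%:SC = v t%:SC) ->
  forall t : R, a < t < b -> d_t u t%:SC = d_t v t%:SC.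
Proof.
move=> uv t tab; rewrite !dt_real; apply: near_eq_derive.
have tI : t \in `]a, b[ by rewrite in_itv.
have /= near_ab := near_in_itvoo tI.
by apply: filterS near_ab => x; rewrite in_itv; exact: uv.
Qed.

(** The class in which the identity theorem is applied: closed under products,
    under multiplication by ['k] and under differentiation. *)
Definition split_analytic A f : Prop :=
  [/\ analytic A (split_Re \o f), analytic A (split_Im \o f) &
      split_holomorphic A f].

Lemma split_analyticP A f :
  analytic A (split_Re \o f) -> analytic A (split_Im \o f) ->
  (forall z, A z -> d_t (split_Re \o f) z = d_s (split_Im \o f) z /\
                    d_s (split_Re \o f) z = d_t (split_Im \o f) z) ->
  split_analytic A f.
Proof.
move=> fR fI CR; split => // u v z Az; have [CR1 CR2] := CR z Az.
by split => //; [exact: analytic_differentiable fR Az|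
  exact: analytic_differentiable fI Az].
Qed.

Lemma split_analyticB A f g : split_analytic A f -> split_analytic A g ->
  split_analytic A (fun z => f z - g z).
Proof.
move=> [fR fI fH] [gR gI gH]; apply: split_analyticP.
- exact: analyticB fR gR.
- exact: analyticB fI gI.
move=> z Az; have [_ _ f1 f2] := fH z Az; have [_ _ g1 g2] := gH z Az.
rewrite /d_t /d_s in f1 f2 g1 g2 *.
have dR h : derivable (split_Re \o f) z h by exact: analytic_derivable fR Az.
have dI h : derivable (split_Im \o f) z h by exact: analytic_derivable fI Az.
have eR h : derivable (split_Re \o g) z h by exact: analytic_derivable gR Az.
have eI h : derivable (split_Im \o g) z h by exact: analytic_derivable gI Az.
split.
  by rewrite (deriveB (dR _) (eR _)) (deriveB (dI _) (eI _)) f1 g1.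
by rewrite (deriveB (dR _) (eR _)) (deriveB (dI _) (eI _)) f2 g2.
Qed.

Lemma split_analyticM A f g : split_analytic A f -> split_analytic A g ->
  split_analytic A (fun z => f z * g z).
Proof.
move=> [fR fI fH] [gR gI gH]; apply: split_analyticP.
- exact: analyticD (analyticM fR gR) (analyticM fI gI).
- exact: analyticD (analyticM fR gI) (analyticM fI gR).
move=> z Az; have [_ _ f1 f2] := fH z Az; have [_ _ g1 g2] := gH z Az.
rewrite /d_t /d_s in f1 f2 g1 g2 *.
have dR h : derivable (split_Re \o f) z h by exact: analytic_derivable fR Az.
have dI h : derivable (split_Im \o f) z h by exact: analytic_derivable fI Az.
have eR h : derivable (split_Re \o g) z h by exact: analytic_derivable gR Az.
have eI h : derivable (split_Im \o g) z h by exact: analytic_derivable gI Az.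
have ReE h : 'D_h (split_Re \o (fun z => f z * g z)) z =
    split_Re (f z) * 'D_h (split_Re \o g) z
    + split_Re (g z) * 'D_h (split_Re \o f) z
    + (split_Im (f z) * 'D_h (split_Im \o g) z
    + split_Im (g z) * 'D_h (split_Im \o f) z).
  have := deriveD (derivableM (dR h) (eR h)) (derivableM (dI h) (eI h)).
  by rewrite (deriveM (dR h) (eR h)) (deriveM (dI h) (eI h)).
have ImE h : 'D_h (split_Im \o (fun z => f z * g z)) z =
    split_Re (f z) * 'D_h (split_Im \o g) z
    + split_Im (g z) * 'D_h (split_Re \o f) z
    + (split_Im (f z) * 'D_h (split_Re \o g) z
    + split_Re (g z) * 'D_h (split_Im \o f) z).
  have := deriveD (derivableM (dR h) (eI h)) (derivableM (dI h) (eR h)).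
  by rewrite (deriveM (dR h) (eI h)) (deriveM (dI h) (eR h)).
by rewrite !ReE !ImE f1 f2 g1 g2; split; ring.
Qed.

Lemma split_analytic_unit A f : split_analytic A f ->
  split_analytic A (fun z => 'k * f z).
Proof.
move=> [fR fI fH].
have eR : split_Re \o (fun z => 'k * f z) = split_Im \o f.
  by apply/funext => z /=; ring.
have eI : split_Im \o (fun z => 'k * f z) = split_Re \o f.
  by apply/funext => z /=; ring.
apply: split_analyticP; rewrite ?eR ?eI// => z Az.
by have [_ _ -> ->] := fH z Az.
Qed.

Definition split_dt f z :=
  SplitC (d_t (split_Re \o f) z) (d_t (split_Im \o f) z).
Definition split_ds f z :=
  SplitC (d_s (split_Re \o f) z) (d_s (split_Im \o f) z).

Lemma split_derivE f : split_deriv f = split_dt f.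
Proof.
by apply/funext => z; congr SplitC => /=; ring.
Qed.

Lemma split_analytic_dt A f : open A -> split_analytic A f ->
  split_analytic A (split_dt f).
Proof.
move=> oA [fR fI fH].
apply: split_analyticP; [exact: analytic_dt fR|exact: analytic_dt fI|].
move=> z Az; split.
  rewrite (analytic_dts fI Az); apply: (dt_eq_open oA) Az => w Aw.
  by have [] := fH w Aw.
rewrite (analytic_dts fR Az); apply: (dt_eq_open oA) Az => w Aw.
by have [] := fH w Aw.
Qed.

Lemma split_analytic_ds A f : open A -> split_analytic A f ->
  split_analytic A (split_ds f).
Proof.
move=> oA [fR fI fH].
apply: split_analyticP; [exact: analytic_ds fR|exact: analytic_ds fI|].
move=> z Az; split.
  rewrite -(analytic_dts fR Az); apply: (ds_eq_open oA) Az => w Aw.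
  by have [] := fH w Aw.
rewrite -(analytic_dts fI Az); apply: (ds_eq_open oA) Az => w Aw.
by have [] := fH w Aw.
Qed.

Definition d_iter u i j := iter i d_t (iter j d_s u).

Lemma analytic_d_iter A u i j : analytic A u -> analytic A (d_iter u i j).
Proof.
rewrite /d_iter => uA; elim: i => [|i IH]; last exact: analytic_dt.
by elim: j => [|j IH] //=; exact: analytic_ds.
Qed.

Lemma d_iter_eq0_open A u i j : open A -> (forall z, A z -> u z = 0) ->
  forall z, A z -> d_iter u i j z = 0.
Proof.
move=> oA u0; rewrite /d_iter.
have dt0 v : (forall z, A z -> v z = 0) -> forall z, A z -> d_t v z = 0.
  move=> v0 z Az; rewrite (dt_eq_open (v := cst 0) oA _ Az)//.
  exact: derive_cst.
have ds0 v : (forall z, A z -> v z = 0) -> forall z, A z -> d_s v z = 0.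
  move=> v0 z Az; rewrite (ds_eq_open (v := cst 0) oA _ Az)//.
  exact: derive_cst.
elim: i => [|i IH]; last exact: dt0.
by elim: j => [|j IH] //; exact: ds0.
Qed.

Lemma expansion_iter_dt_eq0 u z0 r a : expansion u z0 r a ->
  (forall i, iter i d_t u z0 = 0) -> forall i, a i 0%N = 0.
Proof.
move=> ua u0 i; elim: i u r a ua u0 => [|i IH] u r a ua u0.
  by rewrite -(expansion_center ua); exact: (u0 0%N).
have /eqP : d_coef1 a i 0%N = 0.
  by apply: IH (expansion_dt ua) _ => k; rewrite -iterSr.
by rewrite mulf_eq0 pnatr_eq0 => /eqP.
Qed.

Lemma expansion_d_iter_eq0 u z0 r a : expansion u z0 r a ->
  (forall i j, d_iter u i j z0 = 0) -> forall i j, a i j = 0.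
Proof.
move=> ua u0 i j; elim: j u r a ua u0 => [|j IH] u r a ua u0.
  by apply: expansion_iter_dt_eq0 ua _ i => k; exact: (u0 k 0%N).
have /eqP : d_coef2 a i j = 0.
  by apply: IH (expansion_ds ua) _ => k l; rewrite /d_iter -iterSr; exact: u0.
by rewrite mulf_eq0 pnatr_eq0 => /eqP.
Qed.

Lemma expansion_eq0 u z0 r a : expansion u z0 r a ->
  (forall i j, a i j = 0) -> forall z, `|z - z0| < r -> u z = 0.
Proof.
move=> [_ _ ua] a0 z /ua; rewrite (_ : power_sum _ _ _ = cst 0); last first.
  apply/funext => n; rewrite /power_sum /square_sum big1// => i _.
  by rewrite big1// => j _; rewrite a0 mul0r.
by move=> c; apply: cvg_unique c (cvg_cst 0).
Qed.

(** The common zeros of all derivatives form an open set because the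
    coefficients of an expansion are, up to factorials, derivatives at its
    centre, and a relatively closed set because the derivatives are
    continuous. *)
Lemma analytic_identity A u z0 : open A -> connected A -> analytic A u ->
  A z0 -> (forall i j, d_iter u i j z0 = 0) -> forall z, A z -> u z = 0.
Proof.
move=> oA cA uA Az0 u0.
pose S : set (splitC R) := [set z | A z /\ forall i j, d_iter u i j z = 0].
suff <- : S = A by move=> z [_ /(_ 0%N 0%N)].
apply: cA; first by exists z0.
  exists S; last by apply/seteqP; split=> z [] //; move=> ? [].
  rewrite openE => z [Az zS]; have [r [a ua]] := uA z Az.
  have ball0 := expansion_eq0 ua (expansion_d_iter_eq0 ua zS).
  have [r0 _ _] := ua.
  have [e e0 eA] := (near_splitP A z).1 (open_near oA Az).
  pose B : set (splitC R) := ball z (Num.min r e).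
  have BE w : B w -> `|w - z| < Num.min r e.
    by rewrite /B -ball_normE /ball_ /= distrC.
  have oB : open B by apply: ball_open; rewrite lt_min r0.
  have B0 w : B w -> u w = 0.
    by move=> /BE; rewrite lt_min => /andP[wr _]; exact: ball0.
  have Bz : B z by apply: ballxx; rewrite lt_min r0.
  apply: filterS (open_near oB Bz) => w Bw; split.
    by apply: eA; have := BE w Bw; rewrite lt_min => /andP[].
  by move=> i j; exact: d_iter_eq0_open oB B0 _ Bw.
exists (closure S); first exact: closed_closure.
apply/seteqP; split=> z [Az].
  by move=> zS; split=> //; exact: subset_closure.
move=> cz; split=> // i j; apply/eqP/negPn/negP => nz.
have cD := analytic_continuous (analytic_d_iter i j uA) Az.
have [w [[_ wS]]] := cz _ (cvgr_neq0 _ cD nz).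
by rewrite /= wS eqxx.
Qed.

(** Along the real axis only [d_t] matters: [d_s f = 'k * d_t f] turns the
    vanishing of a split-holomorphic function on a real interval into the
    vanishing of all its derivatives there. *)
Lemma split_analytic_d_iter_eq0 A f (a b : R) : open A -> split_analytic A f ->
  (forall t : R, a < t < b -> A t%:SC) ->
  (forall t : R, a < t < b -> f t%:SC = 0) ->
  forall i j (t : R), a < t < b ->
    d_iter (split_Re \o f) i j t%:SC = 0 /\
    d_iter (split_Im \o f) i j t%:SC = 0.
Proof.
move=> oA fA abA.
have dt0 g : (forall t : R, a < t < b -> g t%:SC = 0) ->
    forall t : R, a < t < b -> split_dt g t%:SC = 0.
  move=> g0 t tab; congr SplitC.
    rewrite (dt_eq_real (v := cst 0) _ tab); first exact: derive_cst.
    by move=> s sab; rewrite /= g0.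
  rewrite (dt_eq_real (v := cst 0) _ tab); first exact: derive_cst.
  by move=> s sab; rewrite /= g0.
have ds0 g : split_analytic A g -> (forall t : R, a < t < b -> g t%:SC = 0) ->
    forall t : R, a < t < b -> split_ds g t%:SC = 0.
  move=> [_ _ gH] g0 t tab; have [_ _ g1 g2] := gH _ (abA t tab).
  have := dt0 g g0 t tab; rewrite /split_ds /split_dt g1 g2.
  by move=> [-> ->].
move=> f0 i j; elim: j f fA f0 => [|j IH] f fA f0 t tab.
  elim: i f fA f0 => [|i IH] f fA f0; first by rewrite /d_iter /= f0.
  rewrite /d_iter /= -!iterS !iterSr.
  exact: (IH (split_dt f) (split_analytic_dt oA fA) (dt0 f f0)).
rewrite /d_iter !iterSr.
exact: (IH (split_ds f) (split_analytic_ds oA fA) (ds0 f fA f0) t tab).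
Qed.

Lemma split_analytic_identity A f (a b : R) : open A -> connected A ->
  split_analytic A f -> a < b -> (forall t : R, a < t < b -> A t%:SC) ->
  (forall t : R, a < t < b -> f t%:SC = 0) -> forall z, A z -> f z = 0.
Proof.
move=> oA cA fA ab abA f0 z Az; have [fR fI _] := fA.
have [am mb] := midf_lt ab.
pose m := (a + b) / 2.
have mab : a < m < b by rewrite am mb.
have d0 i j := split_analytic_d_iter_eq0 oA fA abA f0 i j mab.
have := analytic_identity oA cA fR (abA m mab) (fun i j => (d0 i j).1) Az.
have := analytic_identity oA cA fI (abA m mab) (fun i j => (d0 i j).2) Az.
by rewrite /=; case: (f z) => x y /= -> ->.
Qed.

End SplitAnalytic.

(** * Line integrals of exact forms *)

Section PathIntegral.
Context {R : realType}.
Notation mu := (@lebesgue_measure R).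
Implicit Types (A : set (splitC R)) (F : splitC R -> R) (p q : R -> splitC R).

Lemma split_Re_cvg (T : Type) (D : set_system T) (FD : Filter D)
    (f : T -> splitC R) (l : splitC R) :
  f @ D --> l -> (split_Re (f x) @[x --> D]) --> split_Re l.
Proof.
move=> fl; have := @lin_form_continuous R 1 0 l.
rewrite /lin_form (_ : (fun w => _) = split_Re); last first.
  by apply/funext => w; rewrite mul1r mul0r addr0.
by rewrite mul1r mul0r addr0 => c; exact: cvg_comp fl c.
Qed.

Lemma split_Im_cvg (T : Type) (D : set_system T) (FD : Filter D)
    (f : T -> splitC R) (l : splitC R) :
  f @ D --> l -> (split_Im (f x) @[x --> D]) --> split_Im l.
Proof.
move=> fl; have := @lin_form_continuous R 0 1 l.
rewrite /lin_form (_ : (fun w => _) = split_Im); last first.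
  by apply/funext => w; rewrite mul1r mul0r add0r.
by rewrite mul1r mul0r add0r => c; exact: cvg_comp fl c.
Qed.

(** The pullback of the exact form [dF] along [p]. *)
Definition pullback F p (x : R) : R :=
  d_t F (p x) * split_Re (derive1 p x) + d_s F (p x) * split_Im (derive1 p x).

(** The chain rule, by expanding [q'] in the basis [1], ['k]. *)
Lemma derive_pullback A F q (x : R) : analytic A F -> A (q x) ->
  derivable q x 1 ->
  derivable (F \o q) x 1 /\ derive1 (F \o q) x = pullback F q x.
Proof.
move=> FA Aq /derivable1_diffP dq.
have dF := analytic_differentiable FA Aq.
have dFq : differentiable (F \o q) x by exact: differentiable_comp.
split; first exact/derivable1_diffP.
rewrite derive1E' // diff_comp //= -[in LHS]derive1E' // /pullback.
set h := derive1 q x.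
have {1}-> : h = split_Re h *: 1 + split_Im h *: 'k.
  by case: h => u v; congr SplitC => /=; ring.
by rewrite linearD !linearZ -!deriveE// /GRing.scale /= mulrC [X in _ + X]mulrC.
Qed.

(** The path [p] need not be differentiable at the end points of the piece,
    but these do not contribute to the integral; on the open interval [p] and
    its derivative agree with the smooth [q]. Half-open intervals are used so
    that consecutive pieces are disjoint. *)
Lemma integral_pullback_piece A F p q (a b : R) : a < b -> analytic A F ->
  (forall x : R, derivable q x 1) -> continuous (derive1 q) ->
  (forall x : R, a <= x <= b -> p x = q x) ->
  (forall x : R, a <= x <= b -> A (p x)) ->
  measurable_fun `[a, b[ (pullback F p) /\
  (\int[mu]_(x in `[a, b[) (pullback F p x)%:E = (F (p b) - F (p a))%:E)%E.
Proof.
move=> ab FA dq cq pq Ap.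
have aab : a <= a <= b by rewrite lexx ltW.
have bab : a <= b <= b by rewrite lexx ltW.
have Aq x : a <= x <= b -> A (q x) by move=> xab; rewrite -pq//; exact: Ap.
have contq (x : R) : q y @[y --> x] --> q x.
  by apply: differentiable_continuous; exact/derivable1_diffP.
have ccont (x : R) : a <= x <= b ->
    pullback F q y @[y --> x] --> pullback F q x.
  move=> xab; apply: cvgD; apply: cvgM.
  - exact: cvg_comp (contq x) (analytic_continuous (analytic_dt FA) (Aq x xab)).
  - exact: split_Re_cvg (cq x).
  - exact: cvg_comp (contq x) (analytic_continuous (analytic_ds FA) (Aq x xab)).
  - exact: split_Im_cvg (cq x).
have cc : {within `[a, b], continuous (pullback F q)}.
  apply: continuous_in_subspaceT => x; rewrite inE /= in_itv /=.
  exact: ccont.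
have eqpb x : x \in `]a, b[ -> pullback F p x = pullback F q x.
  move=> xab; rewrite /pullback.
  have -> : derive1 p x = derive1 q x.
    rewrite !derive1E; apply: near_eq_derive.
    have /= near_ab := near_in_itvoo xab.
    apply: filterS near_ab => y; rewrite in_itv /= => /andP[ay yb].
    by apply: pq; rewrite !ltW.
  by move: xab; rewrite in_itv /= => /andP[ax xb]; rewrite pq// !ltW.
have mq : measurable_fun `]a, b[ (pullback F q).
  apply: (@measurable_funS _ _ _ _ `[a, b]) => //.
    by apply: subset_itv_oo_cc.
  by apply: subspace_continuous_measurable_fun.
have mp : measurable_fun `]a, b[ (pullback F p).
  by apply: eq_measurable_fun mq => x; rewrite inE /= => xab; rewrite eqpb.
split; first exact/measurable_fun_itv_obnd_cbndP.
have dFq x : a <= x <= b -> derivable (F \o q) x 1.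
  by move=> xab; have [] := derive_pullback FA (Aq x xab) (dq x).
have cFq x : a <= x <= b -> (F \o q) y @[y --> x] --> (F \o q) x.
  move=> xab; apply: differentiable_continuous; apply/derivable1_diffP.
  exact: dFq.
rewrite (@integral_itv_bndoo _ a b _ true true); last exact/measurable_EFinP.
transitivity (\int[mu]_(x in `]a, b[) (pullback F q x)%:E)%E.
  by apply: eq_integral => x; rewrite inE /= => xab; rewrite eqpb.
rewrite -(@integral_itv_bndoo _ a b _ true false); last exact/measurable_EFinP.
rewrite (@continuous_FTC2 _ _ (F \o q))//.
- by rewrite /= -!pq.
- split.
  + move=> x; rewrite in_itv /= => /andP[ax xb].
    by apply: dFq; rewrite !ltW.
  + exact: cvg_at_right_filter (cFq a aab).
  + exact: cvg_at_left_filter (cFq b bab).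
- move=> x; rewrite in_itv /= => /andP[ax xb].
  have xab : a <= x <= b by rewrite !ltW.
  by have [] := derive_pullback FA (Aq x xab) (dq x).
Qed.

Lemma path_le_last (a : R) s : path <%R a s -> a <= last a s.
Proof.
elim: s a => [|b s IH] a //= /andP[ab bs].
by rewrite (le_trans (ltW ab))// IH.
Qed.

Lemma integral_pullback_chain A F p s (a : R) : analytic A F ->
  path <%R a s ->
  (forall i, (i < size s)%N -> exists q : R -> splitC R,
    [/\ forall x : R, derivable q x 1, continuous (derive1 q) &
      forall x : R, nth 0 (a :: s) i <= x <= nth 0 s i -> p x = q x]) ->
  (forall x : R, a <= x <= last a s -> A (p x)) ->
  measurable_fun `[a, last a s[ (pullback F p) /\
  (\int[mu]_(x in `[a, last a s[) (pullback F p x)%:E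
     = (F (p (last a s)) - F (p a))%:E)%E.
Proof.
move=> FA; elim: s a => [|b s IH] a /=.
  move=> _ _ _; rewrite set_itvco0 subrr; split.
    exact: measurable_fun_set0.
  by rewrite integral_set0.
move=> /andP[ab bs] pieces Ap.
have bl := path_le_last bs.
have [q [dq cq pq]] := pieces 0%N isT.
have [|m1 i1] := @integral_pullback_piece A F p q a b ab FA dq cq pq.
  by move=> x /andP[ax xb]; apply: Ap; rewrite ax (le_trans xb).
have [||m2 i2] := IH b bs.
- by move=> i is_; exact: (pieces i.+1 is_).
- by move=> x /andP[bx xl]; apply: Ap; rewrite xl (le_trans (ltW ab)).
have E : `[a, last b s[%classic = `[a, b[%classic `|` `[b, last b s[%classic.
  by apply: itv_bndbnd_setU; rewrite bnd_simp// ltW.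
have mU : measurable_fun (`[a, b[ `|` `[b, last b s[) (pullback F p).
  by apply/measurable_funU.
rewrite E; split=> //.
rewrite integral_setU//=.
- by rewrite i1 i2 -EFinD; congr EFin; ring.
- exact/measurable_EFinP.
- apply/disj_setPS => y [/=]; rewrite 2!in_itv /= => /andP[_ yb] /andP[].
  by rewrite leNgt yb.
Qed.

(** The increments of [F] over the pieces of the path telescope. *)
Lemma Rintegral_pullback A F p z0 z1 : analytic A F -> path_in A z0 z1 p ->
  \int[mu]_(x in `[0, 1]) pullback F p x = F z1 - F z0.
Proof.
move=> FA [[s [s_path s_last pieces]] Ap p0 p1].
have [|m i] := integral_pullback_chain FA s_path pieces.
  by rewrite s_last.
rewrite s_last p0 p1 in m i.
rewrite /Rintegral -integral_itv_bndo_bndc; last exact/measurable_EFinP.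
by rewrite i.
Qed.

End PathIntegral.

(** * Vector-valued functions and the Lorentz product *)

Section Components.
Context {R : realType}.
Implicit Types (A O : set (splitC R)).

(** Applying a norm-nonincreasing linear functional to the vector coefficients
    gives an expansion of the scalar function, at half the radius where the
    absolute series is known to converge. *)
Lemma real_analytic_functional (V : normedModType R) A (f : splitC R -> V)
    (phi : V -> R) :
  (forall x y, phi (x + y) = phi x + phi y) ->
  (forall (c : R) x, phi (c *: x) = c * phi x) ->
  (forall x, `|phi x| <= `|x|) ->
  real_analytic A f -> analytic A (phi \o f).
Proof.
move=> phiD phiZ phi1 fA z0 Az0; have [r [a [r0 fa]]] := fA z0 Az0.
have phi0 : phi 0 = 0 by rewrite -(scale0r 0) phiZ mul0r.
have h0 : 0 < r / 2 by rewrite divr_gt0.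
have hr : r / 2 < r by rewrite ltr_pdivrMr// ltr_pMr// ltr1n.
exists (r / 2), (fun i j => phi (a i j)); split => // [|z zr].
  have zE : z0 + SplitC (r / 2) (r / 2) - z0 = SplitC (r / 2) (r / 2).
    by rewrite addrAC subrr add0r.
  have [] := fa (z0 + SplitC (r / 2) (r / 2)).
    by rewrite zE split_normE /= maxxx ger0_norm// ltW.
  rewrite zE /=.
  pose t i j := `|((r / 2) ^+ i * (r / 2) ^+ j) *: a i j|.
  rewrite -/(square_sum t); set m := square_sum t => cm _.
  have ndm : nondecreasing_seq m.
    apply/nondecreasing_seqP => k.
    rewrite /m square_sumS -addrA lerDl.
    by apply: addr_ge0; apply: sumr_ge0 => i _; exact: normr_ge0.
  exists (limn m) => n; apply: le_trans (nondecreasing_cvgn_le ndm cm n).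
  rewrite /m; apply: (@ler_square_sum R) => i j.
  rewrite /t normrZ mulrC /abs_coef /= !normrM !normrX.
  rewrite (ger0_norm (ltW h0)).
    by apply: ler_wpM2l; rewrite ?mulr_ge0 ?exprn_ge0// ltW.
have [] := fa z (lt_trans zr hr).
set S := fun n : nat => \sum_(i < n) \sum_(j < n) (_ *: _) => _ cS.
rewrite (_ : power_sum _ _ _ = phi \o S); last first.
  apply/funext => n; rewrite /= /S /power_sum /square_sum.
  rewrite (big_morph phi phiD phi0); apply: eq_bigr => i _.
  rewrite (big_morph phi phiD phi0); apply: eq_bigr => j _.
  by rewrite phiZ mulrC.
apply/cvgrPdist_le => e e0; near=> n.
have -> : phi (f z) - phi (S n) = phi (f z - S n).
  by rewrite phiD -[- S n]scaleN1r phiZ mulN1r.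
apply: le_trans (phi1 _) _; near: n.
by move/cvgrPdist_le : cS; apply.
Unshelve. all: by end_near. Qed.

Lemma ler_norm_coord n (v : 'rV[R]_n) j : `|v 0 j| <= `|v|.
Proof.
by rewrite [leRHS]/Num.Def.normr /= mx_normrE (le_bigmax _ _ (0, j)).
Qed.

Lemma real_analytic_coord A n (X : splitC R -> 'rV[R]_n) j :
  real_analytic A X -> analytic A (fun z => X z 0 j).
Proof.
apply: (@real_analytic_functional _ _ _ (fun v : 'rV[R]_n => v 0 j)).
- by move=> x y; rewrite mxE.
- by move=> c x; rewrite mxE.
- by move=> x; exact: ler_norm_coord.
Qed.

Lemma real_analytic_split A (f : splitC R -> splitC R) :
  real_analytic A f -> split_holomorphic A f -> split_analytic A f.
Proof.
move=> fA fH; split => //.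
- exact: real_analytic_functional (@ler_split_Re R) fA.
- exact: real_analytic_functional (@ler_split_Im R) fA.
Qed.

Lemma analytic_eq_open A (f g : splitC R -> R) : open A ->
  (forall z, A z -> f z = g z) -> analytic A f -> analytic A g.
Proof.
move=> oA fg fA z Az; have [r [a fa]] := fA z Az; have [r0 _ _] := fa.
have [e e0 eA] := (near_splitP A z).1 (open_near oA Az).
have m0 : 0 < Num.min r e by rewrite lt_min r0.
have mr : Num.min r e <= r by rewrite ge_min lexx.
have [_ aC fc] := expansion_le m0 mr fa.
exists (Num.min r e), a; split => // w wm.
rewrite -fg; first exact: fc.
by apply: eA; apply: lt_le_trans wm _; rewrite ge_min lexx orbT.
Qed.

Lemma analyticS A B (f : splitC R -> R) :
  A `<=` B -> analytic B f -> analytic A f.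
Proof. by move=> AB fB z /AB; exact: fB. Qed.

Definition row_analytic A (Y : splitC R -> 'rV[R]_3) : Prop :=
  forall j, analytic A (fun z => Y z 0 j).

Lemma row_analytic_derive A Y z h j : row_analytic A Y -> A z ->
  'D_h Y z 0 j = 'D_h (fun w => Y w 0 j) z.
Proof.
move=> YA Az; rewrite derive_mx ?mxE//; apply/derivable_mxP => i k.
by rewrite ord1; exact: analytic_derivable (YA k) Az.
Qed.

Lemma dt_row A Y z j : row_analytic A Y -> A z ->
  d_t Y z 0 j = d_t (fun w => Y w 0 j) z.
Proof. exact: row_analytic_derive. Qed.

Lemma ds_row A Y z j : row_analytic A Y -> A z ->
  d_s Y z 0 j = d_s (fun w => Y w 0 j) z.
Proof. exact: row_analytic_derive. Qed.

Lemma row_analytic_dt A Y :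
  open A -> row_analytic A Y -> row_analytic A (d_t Y).
Proof.
move=> oA YA j; apply: (analytic_eq_open oA _ (analytic_dt (YA j))) => z Az.
by rewrite (dt_row j YA Az).
Qed.

Lemma row_analytic_ds A Y :
  open A -> row_analytic A Y -> row_analytic A (d_s Y).
Proof.
move=> oA YA j; apply: (analytic_eq_open oA _ (analytic_ds (YA j))) => z Az.
by rewrite (ds_row j YA Az).
Qed.

Lemma row_analytic_dts A Y z : open A -> row_analytic A Y -> A z ->
  d_s (d_t Y) z = d_t (d_s Y) z.
Proof.
move=> oA YA Az; apply/rowP => j.
transitivity (d_s (fun w => d_t Y w 0 j) z).
  exact: ds_row (row_analytic_dt oA YA) Az.
transitivity (d_s (d_t (fun w => Y w 0 j)) z).
  by apply: (ds_eq_open oA _ Az) => w Aw; exact: dt_row YA Aw.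
transitivity (d_t (d_s (fun w => Y w 0 j)) z).
  exact: analytic_dts (YA j) Az.
transitivity (d_t (fun w => d_s Y w 0 j) z).
  by apply: (dt_eq_open oA _ Az) => w Aw; apply/esym; exact: ds_row YA Aw.
by apply/esym; exact: dt_row (row_analytic_ds oA YA) Az.
Qed.

Lemma derive_lorentz A (Y Z : splitC R -> 'rV[R]_3) z h :
  row_analytic A Y -> row_analytic A Z -> A z ->
  'D_h (fun w => lorentz (Y w) (Z w)) z =
  lorentz ('D_h Y z) (Z z) + lorentz (Y z) ('D_h Z z).
Proof.
move=> YA ZA Az; rewrite /lorentz !(row_analytic_derive h _ YA Az).
rewrite !(row_analytic_derive h _ ZA Az).
have dY j : derivable (fun w => Y w 0 j) z h.
  exact: analytic_derivable (YA j) Az.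
have dZ j : derivable (fun w => Z w 0 j) z h.
  exact: analytic_derivable (ZA j) Az.
have dM j := derivableM (dY j) (dZ j).
have eM j : 'D_h (fun w => Y w 0 j * Z w 0 j) z =
    Y z 0 j * 'D_h (fun w => Z w 0 j) z + Z z 0 j * 'D_h (fun w => Y w 0 j) z.
  exact: deriveM (dY j) (dZ j).
have := deriveD (derivableD (derivableN (dM (inord 0))) (dM (inord 1)))
  (dM (inord 2)).
rewrite (deriveD (derivableN (dM (inord 0))) (dM (inord 1))).
rewrite (deriveN (dM (inord 0))).
move=> /[!eM] E; rewrite [LHS]E; ring.
Qed.

End Components.

Section LorentzAlgebra.
Context {T : comNzRingType}.
Implicit Types u v w n a b : 'rV[T]_3.

Lemma row3P u v :
  u 0 (inord 0) = v 0 (inord 0) -> u 0 (inord 1) = v 0 (inord 1) ->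
  u 0 (inord 2) = v 0 (inord 2) -> u = v.
Proof.
move=> e0 e1 e2; apply/rowP => j; rewrite -(inord_val j).
by case: j => [[|[|[|]]] //= _].
Qed.

Lemma lorentzC u v : lorentz u v = lorentz v u.
Proof. by rewrite /lorentz; ring. Qed.

Lemma lorentzBl u v w : lorentz (u - v) w = lorentz u w - lorentz v w.
Proof. by rewrite /lorentz !mxE; ring. Qed.

(** Cramer's rule for the three equations of orthogonality: the scalar is the
    determinant of [n], [a], [b]. When it does not vanish, these vectors span
    the space and only [0] is orthogonal to all of them. *)
Lemma lorentz_cramer n a b v :
  lorentz v n = 0 -> lorentz v a = 0 -> lorentz v b = 0 ->
  lorentz (cross n a) b *: v = 0.
Proof.
move=> vn va vb.
set i0 : 'I_3 := inord 0; set i1 : 'I_3 := inord 1; set i2 : 'I_3 := inord 2.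
apply: row3P; rewrite [RHS]mxE.
- transitivity (- (lorentz v n * (a 0 i1 * b 0 i2 - a 0 i2 * b 0 i1)
    - lorentz v a * (n 0 i1 * b 0 i2 - n 0 i2 * b 0 i1)
    + lorentz v b * (n 0 i1 * a 0 i2 - n 0 i2 * a 0 i1))).
    by rewrite /lorentz !mxE !inordK//= -/i0 -/i1 -/i2; ring.
  by rewrite vn va vb; ring.
- transitivity (- lorentz v n * (a 0 i0 * b 0 i2 - a 0 i2 * b 0 i0)
    + lorentz v a * (n 0 i0 * b 0 i2 - n 0 i2 * b 0 i0)
    - lorentz v b * (n 0 i0 * a 0 i2 - n 0 i2 * a 0 i0)).
    by rewrite /lorentz !mxE !inordK//= -/i0 -/i1 -/i2; ring.
  by rewrite vn va vb; ring.
- transitivity (lorentz v n * (a 0 i0 * b 0 i1 - a 0 i1 * b 0 i0)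
    - lorentz v a * (n 0 i0 * b 0 i1 - n 0 i1 * b 0 i0)
    + lorentz v b * (n 0 i0 * a 0 i1 - n 0 i1 * a 0 i0)).
    by rewrite /lorentz !mxE !inordK//= -/i0 -/i1 -/i2; ring.
  by rewrite vn va vb; ring.
Qed.

End LorentzAlgebra.

(** * The wave equation of a minimal surface *)

Section WaveEquation.
Context {R : realType}.
Variables (O : set (splitC R)) (X N : splitC R -> 'rV[R]_3).
Hypotheses (oO : open O) (XO : row_analytic O X).

Lemma derive_lorentz_orthogonal (T S : splitC R -> 'rV[R]_3) z h :
  row_analytic O T -> row_analytic O S -> O z ->
  (forall w, O w -> lorentz (T w) (S w) = 0) ->
  lorentz ('D_h T z) (S z) + lorentz (T z) ('D_h S z) = 0.
Proof.
move=> TA SA Oz TS; rewrite -(derive_lorentz h TA SA Oz).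
transitivity ('D_h (cst 0 : splitC R -> R) z); last exact: derive_cst.
by apply: near_eq_derive; apply: filterS (open_near oO Oz) => w; exact: TS.
Qed.

Lemma derive_lorentz_opposite (T S : splitC R -> 'rV[R]_3) z h :
  row_analytic O T -> row_analytic O S -> O z ->
  (forall w, O w -> lorentz (S w) (S w) = - lorentz (T w) (T w)) ->
  lorentz ('D_h S z) (S z) + lorentz ('D_h T z) (T z) = 0.
Proof.
move=> TA SA Oz SS.
have m j : analytic O (fun w => T w 0 j * T w 0 j) by exact: analyticM.
have lA : analytic O (fun w => lorentz (T w) (T w)).
  have := analyticB (analyticD (m (inord 1)) (m (inord 2))) (m (inord 0)).
  by congr (analytic _ _); apply/funext => w; rewrite /lorentz; ring.
have e : 'D_h (fun w => lorentz (S w) (S w)) z =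
    'D_h (fun w => - lorentz (T w) (T w)) z.
  by apply: near_eq_derive; apply: filterS (open_near oO Oz) => w; exact: SS.
move: e; rewrite (deriveN (analytic_derivable (h := h) lA Oz)).
rewrite (derive_lorentz h SA SA Oz) (derive_lorentz h TA TA Oz).
by rewrite [lorentz (S z) _]lorentzC [lorentz (T z) _]lorentzC => e; lra.
Qed.

Lemma conformal_tangential_algebra (t s tt ts ss : 'rV[R]_3) :
  lorentz tt s + lorentz t ts = 0 -> lorentz ts s + lorentz t ss = 0 ->
  lorentz ts s + lorentz tt t = 0 -> lorentz ss s + lorentz ts t = 0 ->
  lorentz (tt - ss) t = 0 /\ lorentz (tt - ss) s = 0.
Proof.
by rewrite !lorentzBl ![lorentz t _]lorentzC => *; split; lra.
Qed.

(** The four equations of [conformal_tangential_algebra] are the derivatives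
    of the two conformality relations in both directions, with one vector for
    both mixed second derivatives. *)
Lemma conformal_tangential z : conformal O X -> O z ->
  lorentz (d_t (d_t X) z - d_s (d_s X) z) (d_t X z) = 0 /\
  lorentz (d_t (d_t X) z - d_s (d_s X) z) (d_s X z) = 0.
Proof.
move=> cX Oz.
have tA := row_analytic_dt oO XO; have sA := row_analytic_ds oO XO.
have st : d_t (d_s X) z = d_s (d_t X) z.
  by apply/esym; exact: row_analytic_dts oO XO Oz.
have ortho w : O w -> lorentz (d_t X w) (d_s X w) = 0 by case/cX.
have opp w : O w -> lorentz (d_s X w) (d_s X w) = - lorentz (d_t X w) (d_t X w).
  by case/cX.
have orthoD h := derive_lorentz_orthogonal h tA sA Oz ortho.
have oppD h := derive_lorentz_opposite h tA sA Oz opp.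
apply: (conformal_tangential_algebra (ts := d_s (d_t X) z)).
- by rewrite -st; exact: orthoD.
- exact: orthoD.
- by rewrite -{1}st; exact: oppD.
- exact: oppD.
Qed.

Lemma sum_ord2 (F : 'I_2 -> R) : \sum_i F i = F 0 + F 1.
Proof.
by rewrite !big_ord_recl big_ord0 addr0; congr (_ + F _); exact: val_inj.
Qed.

(** In conformal coordinates the first fundamental form is a multiple of [diag
    (-1, 1)], so twice the mean curvature is a multiple of the normal
    component of [d_s (d_s X) - d_t (d_t X)]. *)
Lemma minimal_normal z : conformal O X -> minimal O X N -> O z ->
  lorentz (d_t (d_t X) z - d_s (d_s X) z) (N z) = 0.
Proof.
move=> cX mX Oz; have [ts ss s0] := cX z Oz.
set g := first_form X z; set h := second_form X N z.
pose l := lorentz (d_s X z) (d_s X z).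
have i10 : (1 : 'I_2) == 0 = false by [].
have g00 : g 0 0 = - l.
  by rewrite mxE /coord_deriv eqxx; apply: oppr_inj; rewrite opprK -ss.
have g11 : g 1 1 = l by rewrite mxE /coord_deriv i10.
have g01 : g 0 1 = 0 by rewrite mxE /coord_deriv eqxx i10 ts.
have g10 : g 1 0 = 0 by rewrite mxE /coord_deriv eqxx i10 lorentzC ts.
have ord2 (i : 'I_2) : i = 0 \/ i = 1.
  by case: i => [[|[|//]] lti]; [left|right]; exact: val_inj.
have gu : g \in unitmx.
  rewrite unitmxE unitfE det_trig; last first.
    by apply/is_trig_mxP => i j; case: (ord2 i) => ->; case: (ord2 j) => ->.
  apply/prodf_neq0 => i _; case: (ord2 i) => ->; rewrite ?g00 ?g11 ?oppr_eq0.
    by rewrite gt_eqF.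
  by rewrite gt_eqF.
pose M := invmx g *m h.
have gM : g *m M = h by rewrite mulKVmx.
have h00 : h 0 0 = - l * M 0 0.
  by rewrite -gM mxE sum_ord2 g00 g01 mul0r addr0.
have h11 : h 1 1 = l * M 1 1.
  by rewrite -gM mxE sum_ord2 g10 g11 mul0r add0r.
have trM : M 0 0 + M 1 1 = 0.
  have := mX z Oz; rewrite /mean_curvature -/g -/h -/M /mxtrace sum_ord2.
  by move/eqP; rewrite mulf_eq0 invr_eq0 pnatr_eq0 => /eqP.
rewrite lorentzBl; transitivity (h 0 0 - h 1 1).
  by congr (_ - _); rewrite mxE /coord_deriv ?eqxx ?i10.
by rewrite h00 h11 mulNr -opprD -mulrDr trM mulr0 oppr0.
Qed.

(** [X_tt - X_ss] is orthogonal to the normal and to both tangent vectors; the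
    determinant of this frame is [<N x X_t, X_s> = <X_s, X_s> > 0]. *)
Lemma wave_equation z : conformal O X -> gauss_map O X N -> minimal O X N ->
  O z -> d_t (d_t X) z = d_s (d_s X) z.
Proof.
move=> cX [_ nX] mX Oz.
have [vt vs] := conformal_tangential cX Oz.
have vn := minimal_normal cX mX Oz.
have [_ _ s0] := cX z Oz; have [_ _ _ nt _] := nX z Oz.
have det0 : 0 < lorentz (cross (N z) (d_t X z)) (d_s X z).
  by apply: (eq_ind_r (fun u => 0 < lorentz u (d_s X z)) s0 nt).
have cancel (c : R) (v : 'rV[R]_3) : 0 < c -> c *: v = 0 -> v = 0.
  by move=> c0 /eqP; rewrite scaler_eq0 gt_eqF//= => /eqP.
by apply: subr0_eq; exact: cancel det0 (lorentz_cramer vn vt vs).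
Qed.

End WaveEquation.

(** * The Bjorling representation *)

Section CrossProduct.
Context {R : realType}.
Implicit Types (A : set (splitC R)).

Lemma cross_split_real (u v : 'rV[R]_3) :
  cross (map_mx split_real u) (map_mx split_real v) =
  map_mx split_real (cross u v).
Proof.
by apply: row3P; rewrite !mxE !inordK//=; congr SplitC => /=; ring.
Qed.

Lemma split_analytic_cross A (U V : splitC R -> 'rV[splitC R]_3) :
  (forall j, split_analytic A (fun z => U z 0 j)) ->
  (forall j, split_analytic A (fun z => V z 0 j)) ->
  forall j, split_analytic A (fun z => cross (U z) (V z) 0 j).
Proof.
move=> UA VA j; rewrite -(inord_val j).
have P i k i' k' : split_analytic A (fun z =>
    U z 0 i * V z 0 k - U z 0 i' * V z 0 k').
  by apply: split_analyticB; exact: split_analyticM.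
case: j => [[|[|[|//]]] ltj] /=.
- rewrite (_ : (fun z => _) = (fun z => U z 0 (inord 2) * V z 0 (inord 1)
      - U z 0 (inord 1) * V z 0 (inord 2))); first exact: P.
  by apply/funext => z; rewrite mxE inordK.
- rewrite (_ : (fun z => _) = (fun z => U z 0 (inord 2) * V z 0 (inord 0)
      - U z 0 (inord 0) * V z 0 (inord 2))); first exact: P.
  by apply/funext => z; rewrite mxE inordK.
- rewrite (_ : (fun z => _) = (fun z => U z 0 (inord 0) * V z 0 (inord 1)
      - U z 0 (inord 1) * V z 0 (inord 0))); first exact: P.
  by apply/funext => z; rewrite mxE inordK.
Qed.

End CrossProduct.

Section Representation.
Context {R : realType}.
Variables (Rg : set (splitC R)) (X N : splitC R -> 'rV[R]_3).
Variables (gamma W : splitC R -> 'rV[splitC R]_3).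
Hypotheses (oRg : open Rg) (cRg : connected Rg) (XA : row_analytic Rg X).
Hypothesis wave : forall z, Rg z -> d_t (d_t X) z = d_s (d_s X) z.
Hypothesis XN : forall z, Rg z -> cross (N z) (d_t X z) = d_s X z.
Hypothesis gammaA : forall j, split_analytic Rg (fun z => gamma z 0 j).
Hypothesis WA : forall j, split_analytic Rg (fun z => W z 0 j).
Variables (a b : R).
Hypotheses (ab : a < b) (abRg : forall t : R, a < t < b -> Rg t%:SC).
Hypothesis gammaX : forall t : R, a < t < b ->
  gamma t%:SC = map_mx split_real (X t%:SC).
Hypothesis WN : forall t : R, a < t < b ->
  W t%:SC = map_mx split_real (N t%:SC).

Let E z := cross (W z) (split_deriv_vec gamma z).

(** The wave equation says exactly that [X_t + k' X_s] is split-holomorphic. *)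
Lemma split_analytic_gradient j : split_analytic Rg
  (fun z => SplitC (d_t (fun w => X w 0 j) z) (d_s (fun w => X w 0 j) z)).
Proof.
apply: split_analyticP; [exact: analytic_dt (XA j)|exact: analytic_ds (XA j)|].
move=> z Rz; split; last exact: analytic_dts (XA j) Rz.
transitivity (d_t (fun w => d_t X w 0 j) z).
  by apply: (dt_eq_open oRg _ Rz) => w Rw; apply/esym; exact: dt_row XA Rw.
transitivity (d_t (d_t X) z 0 j).
  by apply/esym; exact: dt_row (row_analytic_dt oRg XA) Rz.
rewrite (wave Rz).
transitivity (d_s (fun w => d_s X w 0 j) z).
  exact: ds_row (row_analytic_ds oRg XA) Rz.
by apply: (ds_eq_open oRg _ Rz) => w Rw; exact: ds_row XA Rw.
Qed.

Lemma split_deriv_row z j :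
  split_deriv_vec gamma z 0 j = split_dt (fun w => gamma w 0 j) z.
Proof. by rewrite mxE split_derivE. Qed.

Lemma split_analytic_integrand j : split_analytic Rg (fun z => E z 0 j).
Proof.
apply: split_analytic_cross => // k.
have := split_analytic_dt oRg (gammaA k); congr (split_analytic _ _).
by apply/funext => z; rewrite split_deriv_row.
Qed.

(** On the real axis [gamma] is real and equal to [X], so its imaginary part
    contributes nothing to [gamma']. *)
Lemma split_deriv_real (t : R) : a < t < b ->
  split_deriv_vec gamma t%:SC = map_mx split_real (d_t X t%:SC).
Proof.
move=> tab; apply/rowP => j; rewrite split_deriv_row mxE; congr SplitC.
  transitivity (d_t (fun w => X w 0 j) t%:SC); last first.
    by apply/esym; exact: dt_row XA (abRg tab).
  by apply: (dt_eq_real _ tab) => s sab; rewrite /= gammaX// mxE.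
transitivity (d_t (cst 0 : splitC R -> R) t%:SC); last exact: derive_cst.
by apply: (dt_eq_real _ tab) => s sab; rewrite /= gammaX// mxE.
Qed.

(** Both sides are split-holomorphic and analytic, and on the interval they
    are both equal to [X_t + k' X_s], since there [gamma' = X_t] and [W x
    gamma' = N x X_t = X_s]. *)
Lemma gradient_decomposition j z : Rg z ->
  SplitC (d_t (fun w => X w 0 j) z) (d_s (fun w => X w 0 j) z) =
  split_dt (fun w => gamma w 0 j) z + 'k * E z 0 j.
Proof.
move=> Rz.
have KA := split_analyticB (split_analyticB (split_analytic_gradient j)
  (split_analytic_dt oRg (gammaA j)))
  (split_analytic_unit (split_analytic_integrand j)).
have K0 := split_analytic_identity oRg cRg KA ab abRg _ Rz.
apply/eqP; rewrite -subr_eq0 opprD addrA; apply/eqP; apply: K0 => t tab.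
have Et : E t%:SC = map_mx split_real (d_s X t%:SC).
  by rewrite /E WN// split_deriv_real// cross_split_real XN//; exact: abRg.
rewrite -split_deriv_row split_deriv_real// Et !mxE.
have -> : d_t X t%:SC 0 j = d_t (fun w => X w 0 j) t%:SC.
  exact: dt_row XA (abRg tab).
have -> : d_s X t%:SC 0 j = d_s (fun w => X w 0 j) t%:SC.
  exact: ds_row XA (abRg tab).
by congr SplitC => /=; ring.
Qed.

(** By [gradient_decomposition] and the Cauchy-Riemann equations of [gamma],
    the form [Im (E dw)] is the differential of [X - Re gamma]. *)
Lemma representation_component j z0 z p : path_in Rg z0 z p ->
  X z 0 j - split_Re (gamma z 0 j) - (X z0 0 j - split_Re (gamma z0 0 j)) =
  split_Re ('k * line_integral (fun w => E w 0 j) p).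
Proof.
move=> pp.
have [gR gI gH] := gammaA j.
have FA : analytic Rg (fun w => X w 0 j - split_Re (gamma w 0 j)).
  exact: analyticB (XA j) gR.
rewrite -(Rintegral_pullback FA pp).
rewrite /line_integral /= !(mul0r, mul1r, add0r, addr0, mulr0).
apply: eq_Rintegral => x; rewrite inE /= in_itv /= => x01.
have Rx : Rg (p x) by case: pp => _ + _ _; apply.
have [_ _ _ CR] := gH _ Rx.
have [et es] := gradient_decomposition j Rx.
have dX h : derivable (fun w => X w 0 j) (p x) h.
  exact: analytic_derivable (XA j) Rx.
have dG h : derivable (split_Re \o (fun w => gamma w 0 j)) (p x) h.
  exact: analytic_derivable gR Rx.
have pt : d_t (fun w => X w 0 j - split_Re (gamma w 0 j)) (p x) =
    split_Im (E (p x) 0 j).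
  rewrite [LHS](deriveB (dX _) (dG _)) -/(d_t _ _) -/(d_t _ _) et.
  by rewrite /split_dt /=; ring.
have ps : d_s (fun w => X w 0 j - split_Re (gamma w 0 j)) (p x) =
    split_Re (E (p x) 0 j).
  rewrite [LHS](deriveB (dX _) (dG _)) -/(d_s _ _) -/(d_s _ _) es CR.
  by rewrite /split_dt /=; ring.
by rewrite /pullback pt ps /=; ring.
Qed.

End Representation.

Theorem theorem1p1 (R : realType)
    (O : set (splitC R)) (X N : splitC R -> 'rV[R]_3)
    (X_timelike : timelike_surface O X) (X_conformal : conformal O X)
    (X_gauss : gauss_map O X N) (X_minimal : minimal O X N)
    (I : set R) (I_interval : nondegenerate_interval I)
    (I_sub : forall t, I t -> O t%:SC)
    (Rg : set (splitC R)) (Rg_domain : domain Rg)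
    (Rg_simply_connected : simply_connected Rg)
    (Rg_sub : Rg `<=` O) (I_Rg : forall t, I t -> Rg t%:SC)
    (gamma W : splitC R -> 'rV[splitC R]_3)
    (gamma_ext : split_extension Rg I (fun t => X t%:SC) gamma)
    (W_ext : split_extension Rg I (fun t => N t%:SC) W)
    (t0 : R) (It0 : I t0) :
  forall z, Rg z -> forall p : R -> splitC R, path_in Rg t0%:SC z p ->
  X z = map_mx split_Re
    (gamma z +
     'k *: line_integral_vec
             (fun w => cross (W w) (split_deriv_vec gamma w)) p).
Proof.
move=> z Rz p pp.
have [[_ oO _] XO _ _] := X_timelike.
have [_ nX] := X_gauss.
have [_ oRg cRg] := Rg_domain.
have [gH gA gX] := gamma_ext; have [wH wA wN] := W_ext.
have [itvI [a [b [Ia Ib ab]]]] := I_interval.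
have abI (t : R) : a < t < b -> I t.
  by move=> /andP[at_ tb]; apply: (itvI a b) => //; rewrite !ltW.
have XAO : row_analytic O X by move=> j; exact: real_analytic_coord.
have XA : row_analytic Rg X by move=> j; exact: analyticS Rg_sub (XAO j).
have wave w : Rg w -> d_t (d_t X) w = d_s (d_s X) w.
  move=> /Rg_sub Ow.
  exact: (wave_equation oO XAO X_conformal X_gauss X_minimal Ow).
have XN w : Rg w -> cross (N w) (d_t X w) = d_s X w.
  by move=> /Rg_sub /nX[].
have gammaA j : split_analytic Rg (fun w => gamma w 0 j).
  exact: real_analytic_split.
have WA j : split_analytic Rg (fun w => W w 0 j) by exact: real_analytic_split.
apply/rowP => j; rewrite !mxE.
(* At [t0] the curve [gamma] passes through [X], which removes the constant. *)
have := representation_component oRg cRg XA wave XN gammaA WA ab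
  (fun t tab => I_Rg t (abI t tab)) (fun t tab => gX t (abI t tab))
  (fun t tab => wN t (abI t tab)) j pp.
rewrite (gX t0 It0) mxE /= subrr subr0 => E.
by rewrite -[LHS](subrK (split_Re (gamma z 0 j))) E addrC.
Qed.
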